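(* Let $K$ be an arbitrary field. Let $\Delta$ be a simplicial complex on $[n]$ and let $\Delta^{\mathrm{lex}}$ be the unique lexsegment simplicial complex on $[n]$ with the same $f$-vector as $\Delta$. Then $$\beta_{i\,i+j}(I_\Delta)\leq\beta_{i\,i+j}(I_{\Delta^{\mathrm{lex}}})$$ for all $i$ and $j$.
   Context: $[n]=\{1,\ldots,n\}$ and $S=K[x_1,\ldots,x_n]$ is the polynomial ring with each $\deg x_i=1$. For a homogeneous ideal $I\subset S$, $\beta_{ij}(I)=\dim_K \mathrm{Tor}^S_i(K,I)_j$ denotes the graded Betti numbers. A simplicial complex $\Delta$ on $[n]$ is a collection of subsets of $[n]$ with $\{j\}\in\Delta$ for all $j\in[n]$ and such that $\tau\subset\sigma\in\Delta$ implies $\tau\in\Delta$. Its $f$-vector is $f(\Delta)=(f_0,f_1,\ldots)$, where $f_i$ is the number of $\sigma\in\Delta$ with $|\sigma|=i+1$. Its Stanley–Reisner ideal $I_\Delta\subset S$ is generated by the squarefree monomials $x_\sigma=\prod_{k\in\sigma}x_k$ with $\sigma\subset[n]$, $\sigma\notin\Delta$. A simplicial complex $\Delta'$ on $[n]$ is lexsegment if $I_{\Delta'}$ is a squarefree lexsegment ideal: whenever $u\in I_{\Delta'}$ is a squarefree monomial and $v$ is a squarefree monomial of $S$ of the same degree with $v>_{\mathrm{lex}}u$ (lexicographic order with $x_1>\cdots>x_n$), then $v\in I_{\Delta'}$. It is known that for each simplicial complex $\Delta$ on $[n]$ there is a unique lexsegment simplicial complex $\Delta^{\mathrm{lex}}$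 on $[n]$ with $f(\Delta^{\mathrm{lex}})=f(\Delta)$. *)

(* Defs.v *)
From mathcomp Require Import all_boot all_order all_algebra.
From mathcomp Require Import mpoly.

Set Implicit Arguments.
Unset Strict Implicit.
Unset Printing Implicit Defensive.

Import GRing.Theory.
Local Open Scope ring_scope.

(* The vertex set [n] = {1, ..., n} is 'I_n and S = K[x_1, ..., x_n] is
   {mpoly K[n]}; the variable x_{k+1} is 'X_k for k : 'I_n. *)

Definition simplicial_complex n (D : {set {set 'I_n}}) : Prop :=
  (forall k, [set k] \in D)
  /\ (forall s t : {set 'I_n}, s \in D -> t \subset s -> t \in D).

Definition fvector n (D : {set {set 'I_n}}) (i : nat) : nat :=
  #|[set s in D | #|s| == i.+1]|.

Definition sr_ideal (K : fieldType) n (D : {set {set 'I_n}})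
    (p : {mpoly K[n]}) : Prop :=
  exists c : {set 'I_n} -> {mpoly K[n]},
    p = \sum_(s : {set 'I_n} | s \notin D) c s * \prod_(k in s) 'X_k.

Definition squarefree_mnm n (m : 'X_{1..n}) : Prop := forall k, (m k <= 1)%N.

(* Lexicographic order with x_1 > ... > x_n, on monomials given by their
   exponents; the order of the mpoly library is a different one. *)
Definition mnm_lex_gt n (v u : 'X_{1..n}) : Prop :=
  exists k : 'I_n,
    (u k < v k)%N /\ (forall l : 'I_n, (l < k)%N -> v l = u l).

Definition lexsegment (K : fieldType) n (D : {set {set 'I_n}}) : Prop :=
  forall u v : 'X_{1..n},
    squarefree_mnm u -> squarefree_mnm v -> mdeg v = mdeg u ->
    mnm_lex_gt v u ->
    sr_ideal D ('X_[u] : {mpoly K[n]}) -> sr_ideal D ('X_[v] : {mpoly K[n]}).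

(* Degrees are integers, so that graded free modules may be generated in
   arbitrary degrees; 0 is homogeneous of every degree, and it is the only
   homogeneous element of negative degree. *)
Definition homog_of_degree (K : fieldType) n (d : int) (p : {mpoly K[n]}) :
    Prop :=
  forall m, m \in msupp p -> (mdeg m)%:Z = d.

(* Graded free S-modules of finite rank and maps between them
     ... -> F_2 -> F_1 -> F_0 -> S.
   Elements of F_i are row vectors, the basis element e_a of F_i has degree
   [fdeg i a] (so F_i is the direct sum of the S(- fdeg i a)), and matrices act
   on the right: [diff i] is the map F_{i+1} -> F_i and [aug] is F_0 -> S. *)
Record free_chain (K : fieldType) (n : nat) := FreeChain {
  frank : nat -> nat;
  fdeg : forall i, 'I_(frank i) -> int;
  diff : forall i, 'M[{mpoly K[n]}]_(frank i.+1, frank i);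
  aug : 'cV[{mpoly K[n]}]_(frank 0)
}.

(* F is a graded free resolution of the ideal I: all maps are homogeneous of
   degree 0 and  ... -> F_1 -> F_0 -> I -> 0  is exact. *)
Record graded_free_resolution (K : fieldType) (n : nat)
    (I : {mpoly K[n]} -> Prop) (F : free_chain K n) : Prop := {
  aug_homog : forall a : 'I_(frank F 0),
    homog_of_degree (fdeg a) (aug F a 0);
  diff_homog : forall i (a : 'I_(frank F i.+1)) (b : 'I_(frank F i)),
    homog_of_degree (fdeg a - fdeg b) (diff F i a b);
  aug_image : forall p : {mpoly K[n]},
    I p <-> exists v : 'rV_(frank F 0), v *m aug F = p%:M;
  aug_exact : forall v : 'rV_(frank F 0),
    v *m aug F = 0 <-> exists w, v = w *m diff F 0;
  diff_exact : forall i (v : 'rV_(frank F i.+1)),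
    v *m diff F i = 0 <-> exists w, v = w *m diff F i.+1
}.

Section Tor.
Variables (K : fieldType) (n : nat) (F : free_chain K n).

(* K = S / (x_1, ..., x_n), so K (x)_S F_i is K^(frank F i), still with basis
   element a in degree [fdeg a], and the differential of K (x)_S F is given by
   the constant coefficients of that of F. *)
Definition tensor_diff i : 'M[K]_(frank F i.+1, frank F i) :=
  map_mx (mcoeff 0%MM) (diff F i).

(* Its row space is the degree j component of K (x)_S F_i. *)
Definition degree_part i (j : int) : 'M[K]_(frank F i) :=
  diag_mx (\row_a (fdeg a == j)%:R).

Definition tor_cycles i (j : int) : 'M[K]_(frank F i) :=
  match i with
  | 0 => degree_part 0 j
  | i'.+1 => (degree_part i'.+1 j :&: kermx (tensor_diff i'))%MS
  end.

Definition tor_boundaries i (j : int) : 'M[K]_(frank F i.+1, frank F i) :=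
  degree_part i.+1 j *m tensor_diff i.

(* When F is a graded free resolution of I, this is
   beta_{i j}(I) = dim_K Tor^S_i(K, I)_j = dim_K H_i(K (x)_S F)_j.
   In :\: the quotient of the cycles by the boundaries is represented by a
   complement of the boundaries in the cycles. *)
Definition betti i (j : int) : nat :=
  \rank (tor_cycles i j :\: tor_boundaries i j)%MS.

End Tor.

(* Main.v *)
From HB Require Import structures.
Require Import Defs.
From mathcomp Require Import all_boot all_order all_algebra.
From mathcomp Require Import mpoly.
From mathcomp Require Import zify ring.

Set Implicit Arguments.
Unset Strict Implicit.
Unset Printing Implicit Defensive.

(** Hochster's formula turns the Betti numbers of a Stanley-Reisner ideal into
    ranks of simplicial boundary maps, and lexsegments minimise these ranks.

    Betti numbers. A graded free resolution F of I and the Koszul complex both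
    compute Tor(K, I): a class of K (x) F is carried by a zig-zag of exact
    sequences to a Koszul homology class of I ([betti_koszul]). The Koszul
    complex splits by multidegrees. In a multidegree that is not squarefree the
    part coming from a monomial ideal is a cone, hence acyclic; in the squarefree
    multidegree W it is spanned by the e_s x^(W \ s) with W \ s not a face, and
    its differential is the boundary map of a simplex ([koszul_hochster]). With
    A_p the set of nonfaces of size j - p and R_p the rank of the boundary on the
    span of all pairs (W, s) with s included in W, #|s| = p and W \ s in A_p,
      beta_(p, j)(I) = #pairs - R_p(A_p) - R_(p+1)(A_(p+1))
    ([betti_sr_ideal]). The number of pairs depends only on the size of A_p,
    that is, on the f-vector.

    Ranks. It remains to see that among the families A of d-element sets of a
    given size R_p is smallest on a lexicographic segment ([bd_rank_lex_le]); each d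
    can be treated separately.
    Combinatorial shifting does not increase R_p, because identifying two
    vertices is a chain map whose image and kernel together contain the span of
    the shifted family ([bd_rank_shift]). Repeated shifting leads to a shifted
    family, and for every family R_p is at least the number of pairs (W, s) with
    max W in s, with equality for shifted ones, by coning with apex max W
    ([bd_rank_ge], [bd_rank_le]). This number is
      sum over v of #{sigma in A : sigma < v} * binomial (v - d, p - 1),
    so that it suffices to know that a shifted family has at least as many
    members below v as a lexicographic segment of at most its size. That is a
    form of the Kruskal-Katona theorem for shifted families, proved by induction
    on the number of vertices ([card_inside_lex_initial]). *)

(** * Shifted families and lexicographic segments *)

Section Lex.
Variable N : nat.
Implicit Types (s t u v : {set 'I_N}) (A L I : {set {set 'I_N}}) (x y : 'I_N).

Definition initial (m : nat) : {set 'I_N} := [set x : 'I_N | (x < m)%N].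

Definition inside m A := [set s in A | s \subset initial m].

Definition uniform d A := forall s, s \in A -> #|s| = d.

Definition shifted A := forall s x y,
  s \in A -> x \in s -> y \notin s -> (y < x)%N -> y |: s :\ x \in A.

Definition lex_gt v u :=
  [exists k : 'I_N, [&& k \in v, k \notin u &
    [forall l : 'I_N, (l < k)%N ==> ((l \in v) == (l \in u))]]].

Definition lex_initial m L := forall u v,
  u \in L -> #|v| = #|u| -> v \subset initial m -> lex_gt v u -> v \in L.

Lemma lex_gtP v u : reflect (exists k, [/\ k \in v, k \notin u &
   forall l : 'I_N, (l < k)%N -> (l \in v) = (l \in u)]) (lex_gt v u).
Proof.
apply: (iffP existsP) => [[k /and3P[kv ku /forallP h]]|[k [kv ku h]]]; exists k.
  by split=> // l lk; apply/eqP; have := h l; rewrite lk.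
by rewrite kv ku; apply/forallP=> l; apply/implyP=> lk; rewrite h.
Qed.

Lemma lex_gt_total u v : u != v -> lex_gt u v || lex_gt v u.
Proof.
move=> uv; have [x0 hx0] : exists x, (x \in u) != (x \in v).
  apply/existsP; apply: contraR uv; rewrite negb_exists => /forallP h.
  by apply/eqP/setP=> x; apply/eqP; have := h x; rewrite negbK.
case: (@arg_minnP _ x0 (fun x => (x \in u) != (x \in v)) (fun x => x : nat) hx0) => k hk kmin.
have below (l : 'I_N) : (l < k)%N -> (l \in u) = (l \in v).
  by move=> lk; apply/eqP; apply: contraLR lk => /kmin; rewrite -leqNgt.
apply/orP; case ku: (k \in u); [left|right]; apply/lex_gtP; exists k.
  by split=> //; move: hk; rewrite ku; case: (k \in v).
by split=> [|//|l /below //]; [move: hk; rewrite ku; case: (k \in v)|rewrite ku].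
Qed.

(** The characteristic vector of s read in binary, small elements being the most
    significant digits. It linearises [lex_gt] and increases when an element
    moves down, so it serves to pick maxima and to see that shifting stops. *)
Definition weight s := (\sum_(k in s) 2 ^ (N - k))%N.

Lemma sum_pow2_lt m : (m <= N)%N -> (\sum_(m <= l < N) 2 ^ (N - l) < 2 ^ (N - m).+1)%N.
Proof.
move=> mN; rewrite -(subKn mN); elim: (N - m)%N (leq_subr m N) => [|k IHk] kN.
  by rewrite subn0 big_geq // expn_gt0.
have {}IHk := IHk (ltnW kN).
rewrite big_ltn; last lia.
have -> : (N - k.+1).+1 = (N - k)%N by lia.
have -> : (N - (N - k.+1) = k.+1)%N by lia.
have e : (N - (N - k) = k)%N by lia.
rewrite e in IHk; rewrite [in X in (_ < X)%N]expnS; lia.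
Qed.

Lemma lex_gt_weight v u : lex_gt v u -> (weight u < weight v)%N.
Proof.
case/lex_gtP=> k [kv ku below]; rewrite /weight.
rewrite (bigID (fun l : 'I_N => (l < k)%N)) /=.
rewrite [X in (_ < X)%N](bigID (fun l : 'I_N => (l < k)%N)) /=.
rewrite (eq_bigl (fun l : 'I_N => (l \in v) && (l < k)%N)); last first.
  by move=> l /=; case: ltnP => // lk; rewrite ?andbF // below.
rewrite ltn_add2l.
have tail : (\sum_(l in u | ~~ (l < k)%N) 2 ^ (N - l)
             <= \sum_(k.+1 <= l < N) 2 ^ (N - l))%N.
  rewrite (big_nat_widenl _ 0) // big_mkord big_mkcond [leqRHS]big_mkcond /=.
  apply: leq_sum => l _; case: ifP => // /andP[lu lk]; rewrite ifT //.
  rewrite ltn_neqAle leqNgt lk andbT; apply: contraNneq ku => /ord_inj ->; exact: lu.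
apply: leq_ltn_trans tail _; apply: leq_trans (sum_pow2_lt (ltn_ord k)) _.
rewrite (_ : (N - k.+1).+1 = (N - k)%N); last by have := ltn_ord k; lia.
by rewrite (bigD1 k) ?kv ?ltnn // leq_addr.
Qed.

Lemma lex_gt_swap s x y :
  x \in s -> y \notin s -> (y < x)%N -> lex_gt (y |: s :\ x) s.
Proof.
move=> xs ys yx; apply/lex_gtP; exists y; rewrite setU11; split=> // l ly.
by rewrite !inE -!val_eqE (ltn_eqF ly) (ltn_eqF (ltn_trans ly yx)).
Qed.

Lemma card_swap s x y : x \in s -> y \notin s -> #|y |: s :\ x| = #|s|.
Proof.
by move=> xs ys; rewrite cardsU1 !inE negb_and (negPf ys) orbT (cardsD1 x s) xs.
Qed.

Lemma lex_initial_shifted L : lex_initial N L -> shifted L.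
Proof.
move=> Linit s x y sL xs ys yx.
apply: (Linit s) (lex_gt_swap xs ys yx) => //; first exact: card_swap.
by apply/subsetP=> z _; rewrite inE ltn_ord.
Qed.

(** Adding a heaviest missing set to a segment gives a segment, so segments grow
    one set at a time. *)
Lemma exists_lex_initial m d a :
  (a <= #|[set s : {set 'I_N} | (s \subset initial m) && (#|s| == d)]|)%N ->
  exists I, [/\ {in I, forall s, s \subset initial m}, uniform d I,
                lex_initial m I & #|I| = a].
Proof.
set X := [set s : {set 'I_N} | _]; elim: a => [|a IHa] aX.
  by exists set0; split=> [s|s|u v|]; rewrite ?inE ?cards0.
have [I [Isub Iu Iinit Ia]] := IHa (ltnW aX).
have IX : I \subset X.
  by apply/subsetP=> s sI; rewrite inE Isub // (Iu s sI) eqxx.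
have [s0 s0P] : exists s, s \in X :\: I.
  by apply/set0Pn; rewrite -card_gt0 cardsD (setIidPr IX) Ia subn_gt0.
case: (@arg_maxnP _ s0 (fun s => s \in X :\: I) weight s0P) => s sXI smax.
have [sI sX] : s \notin I /\ s \in X by move: sXI; rewrite inE => /andP.
have [ssub sd] : s \subset initial m /\ #|s| = d.
  by move: sX; rewrite inE => /andP[? /eqP].
exists (s |: I); split.
- by move=> t; rewrite !inE => /orP[/eqP -> //|]; apply: Isub.
- by move=> t; rewrite !inE => /orP[/eqP -> //|]; apply: Iu.
- move=> u v uI vu vsub vgu.
  have ud : #|u| = d by move: uI; rewrite !inE => /orP[/eqP -> //|]; apply: Iu.
  have [vI|vI] := boolP (v \in I); first by rewrite !inE vI orbT.
  have vXI : v \in X :\: I by rewrite inE vI inE vsub vu ud eqxx.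
  move: uI; rewrite !inE => /orP[/eqP us|uI]; last first.
    by rewrite (Iinit u v) // orbT.
  have /= := smax v vXI; rewrite /= leqNgt; subst u.
  by rewrite (lex_gt_weight vgu).
- by rewrite cardsU1 sI Ia.
Qed.

Lemma sub_initial m1 m2 : (m1 <= m2)%N -> initial m1 \subset initial m2.
Proof. by move=> h; apply/subsetP=> x; rewrite !inE => /leq_trans; apply. Qed.

Lemma inside_inside m1 m2 A :
  (m1 <= m2)%N -> inside m1 (inside m2 A) = inside m1 A.
Proof.
move=> h; apply/setP=> s; rewrite !inE -andbA; congr (_ && _).
case h1: (s \subset initial m1); rewrite ?andbF ?andbT //.
exact: subset_trans h1 (sub_initial h).
Qed.

Lemma inside_id m A :
  {in A, forall s, s \subset initial m} -> inside m A = A.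
Proof.
by move=> h; apply/setP=> s; rewrite !inE andb_idr //; apply: h.
Qed.

Definition link x A := [set s :\ x | s in [set s in A | x \in s]].

Lemma linkP x A t : (t \in link x A) = (x \notin t) && (x |: t \in A).
Proof.
apply/imsetP/andP=> [[s]|[xt tA]].
  by rewrite inE => /andP[sA xs] ->; rewrite setD11 setD1K.
by exists (x |: t); rewrite ?inE ?tA ?eqxx // setU1K.
Qed.

Lemma sub_initialS x s : s \subset initial x.+1 ->
  (s \subset initial x) = (x \notin s).
Proof.
move=> ss; apply/idP/idP=> [/subsetP h|xs].
  by apply/negP=> /h; rewrite inE ltnn.
apply/subsetP=> y ys; rewrite inE ltn_neqAle.
have := subsetP ss y ys; rewrite inE ltnS => ->; rewrite andbT.
by apply: contraNneq xs => /ord_inj <-.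
Qed.

Lemma card_link_inside x A : {in A, forall s, s \subset initial x.+1} ->
  #|A| = (#|link x A| + #|inside x A|)%N.
Proof.
move=> Asub; rewrite -(cardsID [set s : {set 'I_N} | x \in s] A); congr (_ + _)%N.
  rewrite card_in_imset; last first.
    move=> s t; rewrite !inE => /andP[_ xs] /andP[_ xt] e.
    by rewrite -(setD1K xs) e setD1K.
  by apply: eq_card => s; rewrite !inE.
apply: eq_card => s; rewrite !inE andbC; case sA: (s \in A) => //=.
by rewrite sub_initialS // Asub.
Qed.

(** Encodes the sets v |: t with t in A below v: reading off the largest element
    recovers (v, t), and each t contributes one set for every v above it. For a
    shifted family these are all the members of its upper shadow in initial m. *)
Definition pairs m A := [set p : 'I_N * {set 'I_N} |
  [&& (p.1 < m)%N, p.2 \in A & p.2 \subset initial p.1]].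

Lemma card_pairs m A :
  #|pairs m A| = (\sum_(v < N | (v < m)%N) #|inside v A|)%N.
Proof.
rewrite -sum1_card (eq_bigl (fun p : 'I_N * {set 'I_N} => (p.1 < m)%N
   && ((p.2 \in A) && (p.2 \subset initial p.1)))); last by move=> p; rewrite inE.
rewrite -(pair_big_dep (fun v : 'I_N => (v < m)%N)
   (fun (v : 'I_N) (s : {set 'I_N}) => (s \in A) && (s \subset initial v))
   (fun _ _ => 1%N)) /=.
by apply: eq_bigr => v _; rewrite sum1_card; apply: eq_card => s; rewrite !inE.
Qed.

Lemma pair_max_inj m A :
  {in pairs m A &, injective (fun p : 'I_N * {set 'I_N} => p.1 |: p.2)}.
Proof.
move=> [x s] [y t]; rewrite !inE /= => /and3P[_ _ sx] /and3P[_ _ ty] e.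
have bound (z w : 'I_N) (r : {set 'I_N}) : r \subset initial w -> z \in w |: r -> (z <= w)%N.
  move=> /subsetP h; rewrite !inE => /orP[/eqP -> //|/h].
  by rewrite inE; apply: ltnW.
have xy : x = y.
  apply: ord_inj; apply/eqP; rewrite eqn_leq.
  by rewrite (bound _ _ _ ty) ?(bound _ _ _ sx) // -?e ?setU11 // e setU11.
have xs : x \notin s by apply/negP=> /(subsetP sx); rewrite inE ltnn.
have yt : y \notin t by apply/negP=> /(subsetP ty); rewrite inE ltnn.
by rewrite -(setU1K xs) e xy setU1K.
Qed.

Lemma max_elt s : s != set0 ->
  exists2 x, x \in s & s :\ x \subset initial x.
Proof.
case/set0Pn=> x0 x0s; case: (@arg_maxnP _ x0 (fun x => x \in s) (fun x => x : nat) x0s) => x xs xmax.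
exists x => //; apply/subsetP=> y; rewrite !inE => /andP[yx ys].
have /= := xmax y ys; rewrite leq_eqVlt => /orP[/eqP/ord_inj e|//].
by rewrite e eqxx in yx.
Qed.

(** If t together with x lies in the shifted family A, then so does t together
    with any smaller v; keeping the v above t makes these sets distinct. *)
Lemma card_upper_shadow x A : shifted A ->
  (#|pairs x (link x A)| <= #|inside x A|)%N.
Proof.
move=> Ash; rewrite -(card_in_imset (@pair_max_inj x (link x A))).
apply: subset_leq_card; apply/subsetP=> s /imsetP[[v t]].
rewrite inE /= linkP => /and3P[vx /andP[xt tA] tv] ->.
rewrite inE; apply/andP; split.
  have vt : v \notin t by apply/negP=> /(subsetP tv); rewrite inE ltnn.
  have /(_ v) := Ash _ x _ tA (setU11 _ _); rewrite setU1K //; apply=> //.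
  by rewrite !inE negb_or vt andbT -val_eqE neq_ltn vx.
apply/subsetP=> y; rewrite !inE => /orP[/eqP -> //|yt].
by apply: ltn_trans vx; have := subsetP tv y yt; rewrite inE.
Qed.

(** A set s of L precedes x |: t, as L is a segment that misses x |: t. Dropping the
    maximum y of s and x leaves sets of equal size, which are equal or differ
    first at the place where s and x |: t do. *)
Lemma lex_truncate x L I d t :
  lex_initial x.+1 L -> uniform d.+1 L -> {in L, forall s, s \subset initial x.+1} ->
  lex_initial x I -> uniform d I -> {in I, forall s, s \subset initial x} ->
  t \in I -> x |: t \notin L ->
  {in inside x L, forall s y, y \in s -> s :\ y \subset initial y -> s :\ y \in I}.
Proof.
move=> Linit Lu Lsub Iinit Iu Isub tI xtL s; rewrite inE => /andP[sL sx] y ys sy.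
have xt : x \notin t by apply/negP=> /(subsetP (Isub t tI)); rewrite inE ltnn.
have sd : #|s :\ y| = d.
  by have := cardsD1 y s; rewrite ys (Lu s sL) => -[].
have sub : s :\ y \subset initial x by apply: subset_trans sx; apply: subD1set.
have [-> //|ne] := eqVneq (s :\ y) t.
have /orP[gt|/lex_gtP[k [kt ks below]]] := lex_gt_total ne.
  by apply: (Iinit t) => //; rewrite sd Iu.
case/negP: xtL; apply: (Linit s) => //.
- by rewrite cardsU1 xt (Iu t tI) (Lu s sL).
- apply/subsetP=> z; rewrite !inE => /orP[/eqP -> //|zt].
  by have := subsetP (Isub t tI) z zt; rewrite inE => /ltnW.
have kx : (k < x)%N by have := subsetP (Isub t tI) k kt; rewrite inE.
(* s :\ y has as many elements as t, so one of them exceeds k *)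
have [z zs kz] : exists2 z, z \in s :\ y & (k < z)%N.
  apply/exists_inP; apply: contraT; rewrite negb_exists_in => /forall_inP h.
  have : s :\ y \proper t.
    apply/properP; split; last by exists k.
    apply/subsetP=> z zs; rewrite below // ltn_neqAle leqNgt (h z zs) andbT.
    by apply: contraNneq ks => /ord_inj <-.
  by move/proper_card; rewrite sd (Iu t tI) ltnn.
have zy : (z < y)%N by have := subsetP sy z zs; rewrite inE.
have ky := ltn_trans kz zy.
apply/lex_gtP; exists k; split.
- by rewrite !inE kt orbT.
- by move: ks; rewrite !inE -val_eqE (ltn_eqF ky).
- move=> l lk; rewrite !inE -!val_eqE (ltn_eqF (ltn_trans lk kx)) /= below //.
  by rewrite !inE -val_eqE (ltn_eqF (ltn_trans lk ky)).
Qed.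

(** A version of the Kruskal-Katona theorem. Only the sets avoiding the last vertex
    x need an argument. Suppose L has more of them than A; then A has the larger
    link at x. Let I be a segment of the size of the link of A. By induction the
    shadow of the link of A is at least that of I, which contains the truncations
    of all members of L avoiding x because I is larger than the link of L. As A
    contains the shadow of its link, it has as many sets avoiding x as L. *)
Lemma card_inside_lex_initial m d A L : (m <= N)%N ->
  uniform d A -> {in A, forall s, s \subset initial m} -> shifted A ->
  uniform d L -> {in L, forall s, s \subset initial m} -> lex_initial m L ->
  (#|L| <= #|A|)%N ->
  forall w, (#|inside w L| <= #|inside w A|)%N.
Proof.
elim: m d A L => [|m IHm] d A L mN Au Asub Ash Lu Lsub Linit LA w.
  by rewrite !inside_id // => s sB;
     apply: subset_trans (sub_initial (leq0n w)); [apply: Asub | apply: Lsub].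
have [mw|wm] := ltnP m w.
  by rewrite !inside_id // => s sB; apply: subset_trans (sub_initial mw);
     [apply: Asub | apply: Lsub].
pose x := Ordinal mN.
have Lle : (#|inside m L| <= #|inside m A|)%N.
  rewrite leqNgt; apply/negP=> lt.
  have := LA; rewrite (@card_link_inside x L Lsub) (@card_link_inside x A Asub) => LA'.
  rewrite (_ : nat_of_ord x = m) // in LA'.
  have lt1 : (#|link x L| < #|link x A|)%N by lia.
  have [s0 s0A] : exists s, s \in link x A.
    by apply/set0Pn; rewrite -card_gt0; apply: leq_ltn_trans lt1.
  have d_gt0 : (0 < d)%N.
    move: s0A; rewrite linkP => /andP[xs0 /Au <-].
    by apply/card_gt0P; exists x; rewrite setU11.
  have linkU (B : {set {set 'I_N}}) : uniform d B -> uniform d.-1 (link x B).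
    move=> Bu s; rewrite linkP => /andP[xs /Bu].
    by rewrite cardsU1 xs /= => <-.
  have linksub (B : {set {set 'I_N}}) : {in B, forall s, s \subset initial m.+1} ->
      {in link x B, forall s, s \subset initial m}.
    move=> Bsub s; rewrite linkP => /andP[xs /Bsub /subsetP h].
    rewrite (@sub_initialS x) //.
    by apply/subsetP=> y ys; apply: h; rewrite !inE ys orbT.
  have linkSh : shifted (link x A).
    move=> s y z; rewrite !linkP !inE => /andP[xs xsA] ys zs zy.
    have yx : (y < x)%N.
      have := subsetP (linksub A Asub s _) y ys; rewrite linkP xs xsA inE; exact.
    have [xny xnz] : x != y /\ x != z.
      by rewrite -!val_eqE !neq_ltn yx (ltn_trans zy yx) !orbT.
    rewrite (negPf xny) (negPf xnz) (negPf xs) /=.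
    have := Ash _ y z xsA; rewrite !inE ys orbT (negPf zs) eq_sym (negPf xnz) => /(_ isT isT zy).
    rewrite setUCA (_ : (x |: s) :\ y = x |: s :\ y) //; apply/setP=> z1; rewrite !inE.
    by case: (z1 =P x) => [->|] //=; rewrite ?xny.
  have [I [Isub Iu Iinit Icard]] : exists I, [/\ {in I, forall s, s \subset initial m},
       uniform d.-1 I, lex_initial m I & #|I| = #|link x A|].
    apply: exists_lex_initial; apply: subset_leq_card; apply/subsetP=> s sA.
    by rewrite inE (linksub A Asub s sA) (linkU A Au s sA) eqxx.
  have [t tI tL] : exists2 t, t \in I & t \notin link x L.
    by apply/subsetPn; apply/negP=> /subset_leq_card; rewrite Icard leqNgt lt1.
  have xtL : x |: t \notin L.
    move: tL; rewrite linkP; suff -> : x \notin t by [].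
    by apply/negP=> /(subsetP (Isub t tI)); rewrite inE ltnn.
  have Lu' : uniform d.-1.+1 L by rewrite prednK.
  have trunc := @lex_truncate x L I d.-1 t Linit Lu' Lsub Iinit Iu Isub tI xtL.
  have : (#|inside m L| <= #|pairs x I|)%N.
    rewrite -(card_in_imset (@pair_max_inj x I)); apply: subset_leq_card.
    apply/subsetP=> s sL; move: (sL); rewrite inE => /andP[sL' sx].
    have [|y ys sy] := @max_elt s.
      by rewrite -card_gt0 (Lu s sL').
    apply/imsetP; exists (y, s :\ y); last by rewrite /= setD1K.
    rewrite inE /= trunc // sy /= andbT.
    by have := subsetP sx y ys; rewrite inE.
  apply/negP; rewrite -ltnNge; apply: leq_ltn_trans lt.
  apply: leq_trans (card_upper_shadow x Ash); rewrite !card_pairs.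
  apply: leq_sum => v _.
  by apply: (IHm d.-1) => //; [lia|apply: linkU|apply: linksub|rewrite Icard].
rewrite -(@inside_inside w m A) // -(@inside_inside w m L) //.
have mon (B : {set {set 'I_N}}) : {in inside m B, forall s, s \subset initial m}.
  by move=> s; rewrite inE => /andP[].
apply: (IHm d) => //; first lia.
- by move=> s; rewrite inE => /andP[/Au].
- move=> s y z; rewrite !inE => /andP[sA ss] ys zs zy; rewrite Ash //=.
  apply/subsetP=> x1; rewrite !inE => /orP[/eqP ->|/andP[_ /(subsetP ss)]]; last by rewrite inE.
  by apply: ltn_trans zy _; have := subsetP ss y ys; rewrite inE.
- by move=> s; rewrite inE => /andP[/Lu].
- move=> u v; rewrite !inE => /andP[uL us] e vs gt; rewrite vs andbT.
  by apply: (Linit u) => //; apply: subset_trans vs (sub_initial _).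
Qed.

End Lex.

Import GRing.Theory Num.Theory.
Local Open Scope ring_scope.

(** * The exterior algebra as functions on sets *)

Section Exterior.
Variables (K : fieldType) (n : nat).
Implicit Types (g : {set 'I_n} -> K) (s t : {set 'I_n}) (k l : 'I_n).

(** The sign that sorts e_k /\ e_s into the basis vector of k |: s. An element of
    the exterior algebra is represented by the function that maps s to its
    coefficient at e_s. *)
Definition ext_sign k s : K := (-1) ^+ #|[set l in s | (l < k)%N]|.

(** Contraction by the dual basis vector of e_k. *)
Definition contract k g s := if k \in s then 0 else ext_sign k s * g (k |: s).

(** Left multiplication by e_k. *)
Definition wedge k g s := if k \in s then ext_sign k s * g (s :\ k) else 0.

Definition boundary g s := \sum_k contract k g s.

Lemma ext_sign_sqr k s : ext_sign k s * ext_sign k s = 1.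
Proof. by rewrite -expr2 sqrr_sign. Qed.

Lemma ext_sign_neq0 k s : ext_sign k s != 0.
Proof. by rewrite signr_eq0. Qed.

Lemma ext_sign_setU1 k l s :
  l \notin s -> ext_sign k (l |: s) = (-1) ^+ (l < k)%N * ext_sign k s.
Proof.
move=> ls; rewrite /ext_sign -exprD; congr (_ ^+ _).
have [lk|lk] := boolP (l < k)%N.
  rewrite (_ : [set _ in _ | _] = l |: [set x in s | (x < k)%N]).
    by rewrite cardsU1 inE (negPf ls).
  apply/setP=> x; rewrite !inE; case: eqP => [->|] //=; by rewrite lk.
rewrite add0n; apply: eq_card => x; rewrite !inE.
by case: eqP => [->|] //=; rewrite (negPf lk) andbF.
Qed.

Lemma ext_sign_setD1 k l s :
  l \in s -> ext_sign k (s :\ l) = (-1) ^+ (l < k)%N * ext_sign k s.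
Proof.
move=> ls; rewrite -{2}(setD1K ls) ext_sign_setU1 ?setD11 //.
by rewrite mulrA -expr2 sqrr_sign mul1r.
Qed.

Lemma eq_contract g g' k : g =1 g' -> contract k g =1 contract k g'.
Proof. by move=> eq_g s; rewrite /contract eq_g. Qed.

Lemma eq_wedge g g' k : g =1 g' -> wedge k g =1 wedge k g'.
Proof. by move=> eq_g s; rewrite /wedge eq_g. Qed.

Lemma eq_boundary g g' : g =1 g' -> boundary g =1 boundary g'.
Proof. by move=> eq_g s; apply: eq_bigr => k _; apply: eq_contract. Qed.

Lemma contract_wedge_same k g s :
  contract k (wedge k g) s + wedge k (contract k g) s = g s.
Proof.
rewrite /contract /wedge setU11 setD11; case: ifP => ks.
  rewrite add0r ext_sign_setD1 // ltnn mul1r mulrA ext_sign_sqr mul1r.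
  by rewrite setD1K.
by rewrite addr0 ext_sign_setU1 ?ks // ltnn mul1r mulrA ext_sign_sqr mul1r setU1K ?ks.
Qed.

Lemma sign_ltn_neq k l : k != l ->
  (-1) ^+ (k < l)%N = - (-1) ^+ (l < k)%N :> K.
Proof.
rewrite -val_eqE /= neq_ltn => /orP[] h; rewrite h ltnNge ltnW //=;
by rewrite ?expr1 ?expr0 ?opprK.
Qed.

Lemma contract_wedge_neq k l g s :
  k != l -> contract k (wedge l g) s = - wedge l (contract k g) s.
Proof.
move=> kl; rewrite /contract /wedge !inE kl /= [l == k]eq_sym (negPf kl) /=.
case ks: (k \in s); case ls: (l \in s); rewrite ?mulr0 ?oppr0 //.
rewrite ext_sign_setU1 ?ks // ext_sign_setD1 // sign_ltn_neq //.
rewrite (_ : (k |: s) :\ l = k |: s :\ l); first by ring.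
by apply/setP=> x; rewrite !inE; case: (x =P k) => [->|_] //=; rewrite kl.
Qed.

Lemma contract_contract k l g s :
  contract k (contract l g) s = - contract l (contract k g) s.
Proof.
rewrite /contract !inE [l == k]eq_sym; case: (k =P l) => [<-|/eqP kl] /=.
  by case: ifP; rewrite ?mulr0 oppr0.
case ks: (k \in s); case ls: (l \in s); rewrite ?mulr0 ?oppr0 //.
rewrite !ext_sign_setU1 ?ks ?ls // sign_ltn_neq // setUCA; ring.
Qed.

Lemma contractK k g s : contract k (contract k g) s = 0.
Proof. by rewrite /contract setU11 mulr0 if_same. Qed.

Lemma contract_sum (I : Type) (r : seq I) (P : pred I) k (F : I -> {set 'I_n} -> K) s :
  contract k (fun t => \sum_(i <- r | P i) F i t) s
  = \sum_(i <- r | P i) contract k (F i) s.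
Proof.
rewrite /contract; case: ifP => _; first by rewrite big1.
by rewrite mulr_sumr.
Qed.

Lemma wedge_sum (I : Type) (r : seq I) (P : pred I) k (F : I -> {set 'I_n} -> K) s :
  wedge k (fun t => \sum_(i <- r | P i) F i t) s
  = \sum_(i <- r | P i) wedge k (F i) s.
Proof.
rewrite /wedge; case: ifP => _; last by rewrite big1.
by rewrite mulr_sumr.
Qed.

(** Coning with apex k is a contracting homotopy of the full simplex. All the
    acyclicity arguments below are instances of it. *)
Lemma boundary_wedge k g s :
  boundary (wedge k g) s + wedge k (boundary g) s = g s.
Proof.
rewrite wedge_sum -big_split (bigD1 k) //= contract_wedge_same big1 ?addr0 //.
by move=> l lk; rewrite contract_wedge_neq // addNr.
Qed.

(** The diagonal is a separate hypothesis for the sake of characteristic 2. *)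
Lemma sum_antisym (V : zmodType) (T : 'I_n -> 'I_n -> V) :
  (forall k l, T k l = - T l k) -> (forall k, T k k = 0) ->
  \sum_k \sum_l T k l = 0.
Proof.
move=> Ta T0.
have -> : \sum_k \sum_l T k l
        = \sum_(k < n) \sum_(l < n | (l < k)%N) T k l
          + \sum_(k < n) \sum_(l < n | (k < l)%N) T k l.
  rewrite -big_split; apply: eq_bigr => k _.
  rewrite (bigD1 k) //= T0 add0r (bigID (fun l : 'I_n => (l < k)%N)) /=.
  by congr (_ + _); apply: eq_bigl => l; rewrite -val_eqE /=; lia.
rewrite [X in _ + X](exchange_big_dep predT) //= -big_split big1 //= => k _.
by rewrite -big_split big1 //= => l _; rewrite [T k l]Ta addNr.
Qed.

Lemma boundaryK g s : boundary (boundary g) s = 0.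
Proof.
rewrite /boundary (eq_bigr _ (fun k _ => contract_sum _ _ k _ s)).
apply: sum_antisym => [k l|k]; [exact: contract_contract | exact: contractK].
Qed.

(** The algebra endomorphism sending e_i to e_j and fixing the other basis vectors,
    in the form 1 + (e_j - e_i) d_i, from which it inherits the sign rules. *)
Definition substitute i j g s := g s + wedge j (contract i g) s - wedge i (contract i g) s.

Lemma contractD k g h s :
  contract k (fun t => g t + h t) s = contract k g s + contract k h s.
Proof. by rewrite /contract; case: ifP; rewrite ?addr0 ?mulrDr. Qed.

Lemma contractN k g s :
  contract k (fun t => - g t) s = - contract k g s.
Proof. by rewrite /contract; case: ifP; rewrite ?oppr0 ?mulrN. Qed.

Lemma wedgeN k g s :
  wedge k (fun t => - g t) s = - wedge k g s.
Proof. by rewrite /wedge; case: ifP; rewrite ?oppr0 ?mulrN. Qed.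

Lemma boundaryD g h s :
  boundary (fun t => g t + h t) s = boundary g s + boundary h s.
Proof. by rewrite -big_split; apply: eq_bigr => k _; rewrite contractD. Qed.

Lemma boundaryN g s : boundary (fun t => - g t) s = - boundary g s.
Proof. by rewrite -sumrN; apply: eq_bigr => k _; rewrite contractN. Qed.

Lemma boundary_contract k g s :
  boundary (contract k g) s = - contract k (boundary g) s.
Proof.
rewrite contract_sum -sumrN; apply: eq_bigr => l _.
exact: contract_contract.
Qed.

(** The endomorphism respects the boundary because e_i and e_j both have
    boundary 1. *)
Lemma boundary_substitute i j g s :
  boundary (substitute i j g) s = substitute i j (boundary g) s.
Proof.
rewrite boundaryD boundaryD boundaryN.
have bw k : boundary (wedge k (contract i g)) s
          = contract i g s + wedge k (contract i (boundary g)) s.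
  have := boundary_wedge k (contract i g) s.
  have /eq_wedge -> : boundary (contract i g) =1 (fun t => - contract i (boundary g) t).
    exact: boundary_contract.
  by rewrite wedgeN => <-; rewrite subrK.
by rewrite !bw /substitute; ring.
Qed.

End Exterior.

(** * Ranks of boundary maps under shifting *)

Section CoordinateSpaces.
Variables (K : fieldType) (T : finType).
Notation V := {ffun T -> K^o}.
Implicit Types (P : pred T) (f : V).

Definition mask P f : V := [ffun x => if P x then 0 else f x].

Lemma mask_is_linear P : linear (mask P).
Proof.
by move=> a f g; apply/ffunP=> x; rewrite !ffunE; case: ifP; rewrite ?scaler0 ?addr0.
Qed.

HB.instance Definition _ P := GRing.isLinear.Build K V V _ (mask P) (mask_is_linear P).

(** Realised as a kernel to make membership a pointwise condition. *)
Definition coord_space P : {vspace V} := lker (linfun (mask P)).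

Lemma coord_spaceP P f :
  reflect (forall x, ~~ P x -> f x = 0) (f \in coord_space P).
Proof.
rewrite memv_ker lfunE /=; apply: (iffP eqP) => [/ffunP h x Px|h].
  by have := h x; rewrite !ffunE (negPf Px).
by apply/ffunP=> x; rewrite !ffunE; case: ifP => // /negbT; apply: h.
Qed.

Definition point (x : T) : V := [ffun y => (y == x)%:R].

Lemma point_mem P x : P x -> point x \in coord_space P.
Proof.
move=> Px; apply/coord_spaceP=> y; rewrite ffunE; case: eqP => // ->.
by rewrite Px.
Qed.

Lemma sum_point f : f = \sum_x f x *: point x.
Proof.
apply/ffunP=> y; rewrite sum_ffunE (bigD1 y) //= !ffunE eqxx big1.
  by rewrite addr0 /GRing.scale /= mulr1.
by move=> x xy; rewrite !ffunE eq_sym (negPf xy) scaler0.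
Qed.

Lemma coord_space_sub P (X : {vspace V}) :
  (forall x, P x -> point x \in X) -> (coord_space P <= X)%VS.
Proof.
move=> h; apply/subvP=> f /coord_spaceP f0; rewrite (sum_point f).
apply: memv_suml => x _; have [/h|/f0 ->] := boolP (P x); first exact: memvZ.
by rewrite scale0r mem0v.
Qed.

Lemma dim_coord_space P : \dim (coord_space P) = #|P|.
Proof.
have le Q : (\dim (coord_space Q) <= #|Q|)%N.
  have sub : (coord_space Q <= <<[seq point x | x in Q]>>)%VS.
    apply: coord_space_sub => x Qx; apply: memv_span; apply/imageP.
    by exists x.
  apply: leq_trans (dimvS sub) _; apply: leq_trans (dim_span _) _.
  by rewrite size_map -cardE.
apply/eqP; rewrite eqn_leq le /=.
have dV : \dim {:V} = #|T| by rewrite dimvf /dim /= muln1.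
have := limg_ker_dim (linfun (mask P)) fullv; rewrite dV capfv.
have img : (linfun (mask P) @: fullv <= coord_space (predC P))%VS.
  apply/subvP=> _ /memv_imgP[f _ ->]; apply/coord_spaceP=> x.
  by rewrite lfunE /= ffunE negbK => ->.
have arith a b c d e : (a + b = e -> c <= b -> d + c = e -> a <= d)%N by lia.
apply: arith (cardC P) _; exact: leq_trans (dimvS img) (le (predC P)).
Qed.

End CoordinateSpaces.

Ltac set_cases i j facts :=
  let z := fresh "z" in
  apply/setP=> z; rewrite !inE;
  case: (eqVneq z i) => [->|_]; [|case: (eqVneq z j) => [->|_]];
  rewrite ?eqxx ?facts //=.

Section Shift.
Variables (K : fieldType) (n : nat).
Notation T := ({set 'I_n} * {set 'I_n})%type.
Notation V := {ffun T -> K^o}.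
Implicit Types (f : V) (A : {set {set 'I_n}}) (s W : {set 'I_n}).

Definition slot f W : {set 'I_n} -> K := fun s => f (W, s).

Definition bd_fun f : V := [ffun x => boundary (slot f x.1) x.2].

Lemma contractZD k a (g h : {set 'I_n} -> K) s :
  contract k (fun t => a * g t + h t) s = a * contract k g s + contract k h s.
Proof. by rewrite /contract; case: ifP; rewrite ?mulr0 ?addr0 // mulrDr mulrCA. Qed.

Lemma boundaryZD a (g h : {set 'I_n} -> K) s :
  boundary (fun t => a * g t + h t) s = a * boundary g s + boundary h s.
Proof.
rewrite /boundary mulr_sumr -big_split; apply: eq_bigr => k _; exact: contractZD.
Qed.

Lemma slotZD a f f' W : slot (a *: f + f') W =1 fun t => a * slot f W t + slot f' W t.
Proof. by move=> t; rewrite /slot !ffunE. Qed.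

Lemma bd_fun_is_linear : linear bd_fun.
Proof.
move=> a f g; apply/ffunP=> -[W s]; rewrite !ffunE /=.
by rewrite (eq_boundary (slotZD a f g W)) boundaryZD.
Qed.

HB.instance Definition _ := GRing.isLinear.Build K V V _ bd_fun bd_fun_is_linear.

Definition bd : 'End(V) := linfun bd_fun.

Lemma bdE f W s : bd f (W, s) = boundary (slot f W) s.
Proof. by rewrite lfunE /= ffunE. Qed.

(** The cell (W, s) stands for e_s x^(W \ s) in the squarefree multidegree W of the
    Koszul complex; the boundary changes s and keeps W. *)
Definition cells (p : nat) A : pred T :=
  [pred x : T | [&& x.2 \subset x.1, #|x.2| == p & x.1 :\: x.2 \in A]].

Definition bd_rank p A := \dim (bd @: coord_space K (cells p A))%VS.

Lemma substituteE i j (g : {set 'I_n} -> K) s : i != j -> substitute i j g s =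
  if i \in s then 0 else
  if j \in s then g s + ext_sign K j s * ext_sign K i (s :\ j) * g (i |: s :\ j) else g s.
Proof.
move=> ij; rewrite /substitute /wedge /contract !inE eqxx ij.
case is_: (i \in s); case js: (j \in s) => /=; rewrite ?mulr0 ?addr0 ?subr0 //.
- rewrite ext_sign_setD1 // ltnn mul1r mulrA ext_sign_sqr mul1r setD1K //; exact: subrr.
- rewrite ext_sign_setD1 // ltnn mul1r mulrA ext_sign_sqr mul1r setD1K //; exact: subrr.
- by rewrite mulrA.
Qed.

Variables (i j : 'I_n).
Hypothesis ij : (i < j)%N.

Let neq_ij : i != j. Proof. by rewrite -val_eqE neq_ltn ij. Qed.
Let neq_ji : j != i. Proof. by rewrite eq_sym. Qed.

Definition swap_in s := i |: s :\ j.
Definition swap_out s := j |: s :\ i.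

(** The usual shifting operation replaces j by i in the members of A unless the
    result is already present. It is given here by its membership criterion,
    the only thing that the linear algebra uses. *)
Definition shift A := [set s : {set 'I_n} |
  if (i \in s) && (j \notin s) then (s \in A) || (swap_out s \in A)
  else if (j \in s) && (i \notin s) then (s \in A) && (swap_in s \in A)
  else s \in A].

(** Identification of the vertices i and j. In a component W containing both of
    them, e_i becomes e_j; note that this moves s in the direction opposite to
    W \ s. A component containing only j is carried onto the one where i
    replaces j. *)
Definition fold_fun f : V := [ffun x : T =>
  if i \in x.1 then
    if j \in x.1 then substitute i j (slot f x.1) x.2
    else f x + substitute j i (slot f (swap_out x.1)) x.2
  else if j \in x.1 then 0 else f x].

Lemma substituteZD k l a (g h : {set 'I_n} -> K) s : k != l ->
  substitute k l (fun t => a * g t + h t) s = a * substitute k l g s + substitute k l h s.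
Proof.
by move=> kl; rewrite !substituteE //; case: ifP => _; [|case: ifP => _]; ring.
Qed.

Lemma eq_substitute k l (g h : {set 'I_n} -> K) : k != l -> g =1 h -> substitute k l g =1 substitute k l h.
Proof. by move=> kl e s; rewrite !substituteE // !e. Qed.

Lemma fold_fun_is_linear : linear fold_fun.
Proof.
move=> a f g; apply/ffunP=> -[W s]; rewrite !ffunE /= /GRing.scale /=.
rewrite !(eq_substitute _ (slotZD a f g _)) // !substituteZD //.
by case: ifP => _; case: ifP => _; ring.
Qed.

HB.instance Definition _ := GRing.isLinear.Build K V V _ fold_fun fold_fun_is_linear.

Definition fold_map : 'End(V) := linfun fold_fun.

Lemma fold_mapE f x : fold_map f x = fold_fun f x. Proof. by rewrite lfunE. Qed.

Lemma fold_map_bd f : fold_map (bd f) = bd (fold_map f).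
Proof.
apply/ffunP=> -[W s]; rewrite bdE fold_mapE ffunE /=.
have sl (W' : {set 'I_n}) : slot (bd f) W' =1 boundary (slot f W').
  by move=> t; rewrite /slot bdE.
rewrite !(eq_substitute _ (sl _)) // -!boundary_substitute bdE.
case iW: (i \in W); case jW: (j \in W).
- by apply: eq_boundary => t; rewrite /slot fold_mapE ffunE /= iW jW.
- rewrite -boundaryD; apply: eq_boundary => t.
  by rewrite /slot fold_mapE ffunE /= iW jW.
- rewrite /boundary big1 // => k _.
  by rewrite /contract /slot fold_mapE ffunE /= iW jW mulr0 if_same.
- by apply: eq_boundary => t; rewrite /slot fold_mapE ffunE /= iW jW.
Qed.

Lemma fold_mapK f : fold_map (fold_map f) = fold_map f.
Proof.
apply/ffunP=> -[W s]; rewrite fold_mapE [LHS]ffunE /=.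
case iW: (i \in W); case jW: (j \in W).
- rewrite [RHS]fold_mapE ffunE /= iW jW !substituteE //; case: ifP => // is_.
  by case: ifP => // js; rewrite /slot !fold_mapE !ffunE /= iW jW !substituteE // is_ js ?setU11 /= ?mulr0 ?addr0.
- have z t : slot (fold_map f) (swap_out W) t = 0.
    by rewrite /slot fold_mapE ffunE /= !inE !eqxx (negPf neq_ij).
  by rewrite substituteE // !z mulr0 addr0 !if_same addr0.
- by rewrite fold_mapE ffunE /= iW jW.
- by [].
Qed.

(** Besides the given cell the identification can only produce one with the same
    W \ s or with i in place of j in W \ s; in the latter case the shifting
    criterion puts the new W \ s into A. *)
Lemma fold_point p A x :
  cells p (shift A) x -> cells p A x -> fold_map (point K x) \in coord_space K (cells p A).
Proof.
case: x => W0 s0 /and3P[/= sub0 /eqP card0 sh0] /and3P[/= _ _ A0].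
apply/coord_spaceP=> -[W s]; apply: contraNeq; rewrite fold_mapE ffunE /=.
have at_x (W' s' : {set 'I_n}) : slot (point K (W0, s0)) W' s' != 0 -> W0 = W' /\ s0 = s'.
  by rewrite /slot ffunE; case: ((W', s') =P (W0, s0)) => [[<- <-]|_] //; rewrite eqxx.
have here : point K (W0, s0) (W, s) != 0 -> cells p A (W, s).
  by move=> /at_x[<- <-]; apply/and3P; rewrite /= card0 eqxx.
have add_neq0 (a b : K) : a + b != 0 -> a != 0 \/ b != 0.
  by have [->|] := eqVneq a 0; [rewrite add0r; right | left].
case iW: (i \in W); case jW: (j \in W) => /=; rewrite ?eqxx //.
- rewrite substituteE //; case is_: (i \in s); rewrite ?eqxx //.
  case js: (j \in s) => //; case/add_neq0 => [/here //|].
  rewrite !mulf_eq0 => /norP[_ /at_x[eW es]]; subst W0 s0.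
  apply/and3P; split=> /=.
  + apply/subsetP=> z zs; have [-> //|zj] := eqVneq z j.
    by apply: (subsetP sub0); rewrite !inE zj zs orbT.
  + by rewrite -card0 cardsU1 !inE is_ andbF /= (cardsD1 j s) js.
  + move: sh0; rewrite inE !inE !eqxx (negPf neq_ji) iW jW /= => /andP[_].
    congr (_ \in A); set_cases i j (iW, jW, is_, js, negPf neq_ij, negPf neq_ji).
- case/add_neq0 => [/here //|]; rewrite substituteE //; case js: (j \in s); rewrite ?eqxx //.
  have notin (s' : {set 'I_n}) : s' \subset swap_out W -> i \notin s'.
    by move=> h; apply/negP=> /(subsetP h); rewrite !inE eqxx (negPf neq_ij).
  case is_: (i \in s); [case/add_neq0|]; [| |].
  + by case/at_x=> eW es; move: (notin s); rewrite -eW -es sub0 es is_ => /(_ isT).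
  + rewrite !mulf_eq0 => /norP[_ /at_x[eW es]]; subst W0 s0.
    apply/and3P; split=> /=.
    * apply/subsetP=> z zs; have [-> //|zi] := eqVneq z i.
      have zj : z != j by apply: contraTneq zs => ->; rewrite js.
      have := subsetP sub0 z; rewrite !inE (negPf zj) zi zs; exact.
    * by rewrite -card0 cardsU1 !inE js andbF /= (cardsD1 i s) is_.
    * move: A0; congr (_ \in A); set_cases i j (iW, jW, is_, js, negPf neq_ij, negPf neq_ji).
  + case/at_x=> eW es; subst W0 s0.
    apply/and3P; split=> /=.
    * apply/subsetP=> z zs; have [-> //|zi] := eqVneq z i.
      have zj : z != j by apply: contraTneq zs => ->; rewrite js.
      by have := subsetP sub0 z zs; rewrite !inE (negPf zj) zi.
    * by rewrite -card0.
    * move: sh0; rewrite inE !inE !eqxx (negPf neq_ij) is_ jW js /= => /andP[_].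
      congr (_ \in A); set_cases i j (iW, jW, is_, js, negPf neq_ij, negPf neq_ji).
Qed.

(** A cell that is new in the shifted family has W \ s obtained from a member of A
    by replacing j by i; undoing the replacement gives a cell of A which the
    identification sends back to it, up to sign. *)
Lemma fold_new_point p A x :
  cells p (shift A) x -> ~~ cells p A x ->
  exists y c, [/\ cells p A y, c != 0 & fold_map (point K y) = c *: point K x].
Proof.
case: x => W s /and3P[/= sub card sh] ncell.
have nA : W :\: s \notin A by apply: contra ncell => A0; apply/and3P.
move: sh; rewrite inE; case: ifP => [/andP[]|_]; last first.
  by case: ifP => _; [case/andP|]; rewrite (negPf nA).
rewrite (negPf nA) /= !inE => /andP[is_ iW]; rewrite negb_and negbK => jWs swA.
have pointE (W' s' W1 s1 : {set 'I_n}) :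
    slot (point K (W', s')) W1 s1 = ((W1 == W') && (s1 == s'))%:R.
  by rewrite /slot ffunE xpair_eqE.
have pE (W' s' W1 s1 : {set 'I_n}) :
    point K (W', s') (W1, s1) = ((W1 == W') && (s1 == s'))%:R by exact: pointE.
have diff (x : 'I_n) (B C : {set 'I_n}) : x \in B -> x \notin C -> (B == C) = false.
  by move=> xB xC; apply: contraNF xC => /eqP <-.
have diff' (x : 'I_n) (B C : {set 'I_n}) : x \in B -> x \notin C -> (C == B) = false.
  by rewrite eq_sym; apply: diff.
case jW: (j \in W) jWs => /=; rewrite ?orbT ?orbF => js.
- have isF := negPf is_.
  exists (W, i |: s :\ j), (ext_sign K j s * ext_sign K i (s :\ j)); split.
  + apply/and3P; split=> /=.
    * apply/subsetP=> z; rewrite !inE => /orP[/eqP -> //|/andP[_]].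
      exact: (subsetP sub).
    * by move: card; rewrite (cardsD1 j s) js cardsU1 !inE isF andbF.
    * move: swA; congr (_ \in A); set_cases i j (iW, jW, isF, js, negPf neq_ij, negPf neq_ji).
  + by rewrite mulf_neq0 ?ext_sign_neq0.
  apply/ffunP=> -[W1 s1]; rewrite fold_mapE [LHS]ffunE [RHS]ffunE /= !pE /GRing.scale /=.
  have [e|] := eqVneq W1 W; last first.
    move=> ne; rewrite mulr0; case: ifP => iW1; case: ifP => jW1 //.
      by rewrite substituteE // !pointE (negPf ne) /= mulr0 addr0 !if_same.
    rewrite add0r substituteE // !pointE (_ : (swap_out W1 == W) = false) /= ?mulr0 ?addr0 ?if_same //.
    by apply: (diff' i); rewrite ?iW // !inE eqxx (negPf neq_ij).
  subst W1; rewrite iW jW substituteE // !pointE eqxx /=.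
  case i1: (i \in s1); first by rewrite (diff i) // mulr0.
  rewrite (diff' i _ s1) ?setU11 ?i1 // add0r.
  case j1: (j \in s1); last by rewrite (diff' j) ?j1 // mulr0.
  have [->|ne] := eqVneq s1 s; first by rewrite eqxx.
  rewrite (_ : (_ == _) = false) ?mulr0 //; apply: contraNF ne => /eqP e.
  rewrite -(setD1K j1) -[X in _ == X](setD1K js); apply/eqP; congr (_ |: _).
  by rewrite -[LHS](@setU1K _ i) ?e ?setU1K // !inE ?i1 ?isF andbF.
- have isF := negPf is_; have jsF : (j \in s) = false.
    by apply: contraFF jW => /(subsetP sub).
  exists (swap_out W, s), 1; split; last 2 first.
  + exact: oner_neq0.
  + apply/ffunP=> -[W1 s1]; rewrite fold_mapE [LHS]ffunE [RHS]ffunE /= !pE /GRing.scale /= mul1r.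
    have iout (W' : {set 'I_n}) : i \notin swap_out W'.
      by rewrite !inE eqxx (negPf neq_ij).
    case iW1: (i \in W1); case jW1: (j \in W1) => //=.
    * rewrite substituteE // !pointE (diff i W1) ?iout // (diff j W1) ?jW //=.
      by rewrite mulr0 addr0 !if_same.
    * rewrite (diff i W1) ?iout //= add0r substituteE // !pointE.
      case j1: (j \in s1); first by rewrite (diff j s1) ?jsF // andbF.
      have -> : (swap_out W1 == swap_out W) = (W1 == W).
        apply/eqP/eqP=> [e|-> //]; rewrite -(setD1K iW1) -(setD1K iW); congr (_ |: _).
        rewrite -[LHS](@setU1K _ j); last by rewrite !inE jW1 andbF.
        by rewrite [_ |: _]e setU1K // !inE jW andbF.
      case i1: (i \in s1) => //.
      rewrite (diff j (j |: _) s) ?setU11 ?jsF // andbF mulr0 addr0.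
      by rewrite (diff i s1) ?isF.
    * by rewrite (diff j W1) ?jW.
    * by rewrite (diff' j _ W1) ?jW1 ?setU11 // (diff' i _ W1) ?iW1.
  + apply/and3P; split=> //=.
    * apply/subsetP=> z zs; have zW := subsetP sub z zs.
      by rewrite !inE zW andbT orbC; have [zi|] := eqVneq z i; rewrite // -zi zs in isF.
    * move: swA; congr (_ \in A); set_cases i j (iW, jW, isF, jsF, negPf neq_ij, negPf neq_ji).
Qed.

(** Let U be the span of the cells of A, and P the identification of i and j.
    As P commutes with the boundary, the rank on U is at least the rank on P(U)
    plus the rank on the kernel of P in U. Every cell of the shifted family lies
    in the sum of these two spaces. *)
Lemma bd_rank_shift p A : (bd_rank p (shift A) <= bd_rank p A)%N.
Proof.
set U := coord_space K (cells p A).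
(* x = P x + (x - P x) for an old cell x, as P is idempotent *)
have sub : (coord_space K (cells p (shift A)) <= fold_map @: U + (U :&: lker fold_map))%VS.
  apply: coord_space_sub => x xsh.
  have [xA|xA] := boolP (cells p A x).
    rewrite -[point K x](subrK (fold_map (point K x))) addrC.
    apply: memv_add; first by rewrite memv_img // point_mem.
    rewrite memv_cap rpredB ?fold_point ?point_mem //=.
    by rewrite memv_ker linearB /= fold_mapK subrr.
  have [y [c [yA c0 e]]] := fold_new_point xsh xA.
  rewrite -[point K x]addr0 memv_add ?mem0v //.
  rewrite (_ : point K x = fold_map (c^-1 *: point K y)).
    by rewrite memv_img // memvZ // point_mem.
  by rewrite linearZ /= e scalerA mulVf // scale1r.
rewrite /bd_rank -/U; apply: leq_trans (dimvS (limgS _ sub)) _.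
rewrite limgD; apply: leq_trans (dimv_add_leqif _ _) _.
rewrite -(limg_ker_dim fold_map (bd @: U)%VS) addnC leq_add //; apply: dimvS.
  apply/subvP=> _ /memv_imgP[f + ->]; rewrite memv_cap => /andP[fU f0].
  rewrite memv_cap memv_img //= memv_ker fold_map_bd.
  by move: f0; rewrite memv_ker => /eqP ->; rewrite linear0.
apply/subvP=> _ /memv_imgP[_ /memv_imgP[f fU ->] ->].
by rewrite -fold_map_bd memv_img // memv_img.
Qed.

End Shift.

(** * Boundary ranks of shifted families and of segments *)

Section Shifting.
Variables (K : fieldType) (n : nat).
Implicit Types (A B L : {set {set 'I_n}}) (s W : {set 'I_n}) (i j : 'I_n).

Lemma swap_inK i j s : j \in s -> i \notin s -> swap_out i j (swap_in i j s) = s.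
Proof.
move=> js is_; rewrite /swap_out /swap_in setU1K ?setD1K //.
by rewrite !inE (negPf is_) andbF.
Qed.

Lemma card_swap_out i j s : i \in s -> j \notin s -> #|swap_out i j s| = #|s|.
Proof. exact: card_swap. Qed.

Lemma shift_uniform i j d A : uniform d A -> uniform d (shift i j A).
Proof.
move=> Au s; rewrite inE; case: ifP => [/andP[is_ js]|_].
  by case/orP=> /Au //; rewrite card_swap_out.
by case: ifP => _; [case/andP=> /Au|move/Au].
Qed.

Definition total_weight A := (\sum_(s in A) weight s)%N.

(** Sending a member of A to itself if it survives and to its shifted copy
    otherwise is injective into the shifted family and does not decrease
    weights; a set that really moves gains weight. *)
Lemma shift_grows i j A s0 : (i < j)%N ->
  s0 \in A -> j \in s0 -> i \notin s0 -> swap_in i j s0 \notin A ->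
  (#|A| <= #|shift i j A|)%N /\ (total_weight A < total_weight (shift i j A))%N.
Proof.
move=> ij s0A js0 is0 s0new; set C := shift i j A.
have jineq : (j == i) = false by rewrite -val_eqE gtn_eqF.
pose psi s := if s \in C then s else swap_in i j s.
have moved s : s \in A -> s \notin C ->
    [/\ j \in s, i \notin s, swap_in i j s \notin A & swap_in i j s \in C].
  move=> sA; rewrite inE; case: ifP => [_|_]; first by rewrite sA.
  case: ifP => [/andP[js is_]|_]; rewrite sA //= => nA; split=> //.
  by rewrite inE swap_inK // sA !inE !eqxx jineq orbT.
have psiC s : s \in A -> psi s \in C.
  by move=> sA; rewrite /psi; case: ifP => // /negbT /(moved s sA)[].
have psi_inj : {in A &, injective psi}.
  move=> s t sA tA; rewrite /psi.
  case: ifP => [sC|/negbT/(moved s sA)[js is_ sn _]];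
  case: ifP => [tC|/negbT/(moved t tA)[jt it tn _]] // e.
  - by rewrite -e sA in tn.
  - by rewrite e tA in sn.
  - by rewrite -(swap_inK js is_) e swap_inK.
have psi_sub : psi @: A \subset C by apply/subsetP=> _ /imsetP[s sA ->]; apply: psiC.
split; first by rewrite -(card_in_imset psi_inj) subset_leq_card.
have s0C : s0 \notin C.
  by rewrite inE js0 (negPf is0) /= s0A.
have lt0 : (weight s0 < weight (psi s0))%N.
  by rewrite /psi (negPf s0C); apply/lex_gt_weight/lex_gt_swap.
have le s : s \in A -> (weight s <= weight (psi s))%N.
  move=> sA; rewrite /psi; case: ifP => // /negbT/(moved s sA)[js is_ _ _].
  by apply/ltnW/lex_gt_weight/lex_gt_swap.
apply: (@leq_trans (\sum_(s in A) weight (psi s))); last first.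
  rewrite -(big_imset (@weight n) psi_inj) /total_weight.
  rewrite [leqRHS](big_setID (psi @: A)) /=.
  by rewrite (setIidPr psi_sub) leq_addr.
rewrite /total_weight (bigD1 s0) //= [leqRHS](bigD1 s0) //= -addSn leq_add //.
by apply: leq_sum => s /andP[sA _]; apply: le.
Qed.

(** A heaviest family among those that are at least as large and have at most the
    same boundary rank admits no further proper shift. *)
Lemma exists_shifted p d A : uniform d A ->
  exists B, [/\ uniform d B, shifted B, (#|A| <= #|B|)%N
              & (bd_rank K p B <= bd_rank K p A)%N].
Proof.
move=> Au.
pose good B := [&& [forall s in B, #|s| == d], (#|A| <= #|B|)%N
                 & (bd_rank K p B <= bd_rank K p A)%N].
have gA : good A.
  by apply/and3P; split=> //; apply/forall_inP=> s /Au ->.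
case: (@arg_maxnP _ A good total_weight gA) => B /and3P[/forall_inP Bu' AB RB] Bmax.
have Bu : uniform d B by move=> s /Bu' /eqP.
exists B; split=> // s j i sB js is_ ij; apply: contraT => new.
have [cardB ltB] := shift_grows ij sB js is_ new.
suff /Bmax : good (shift i j B) by rewrite /= leqNgt ltB.
apply/and3P; split.
- by apply/forall_inP=> t /(shift_uniform Bu) ->.
- exact: leq_trans AB cardB.
- exact: leq_trans (bd_rank_shift K ij p B) RB.
Qed.

End Shifting.

Section Cone.
Variables (K : fieldType) (n : nat) (x0 : 'I_n).
Notation T := ({set 'I_n} * {set 'I_n})%type.
Notation V := {ffun T -> K^o}.
Implicit Types (A B L : {set {set 'I_n}}) (s W : {set 'I_n}) (i j : 'I_n).

Definition top W := odflt x0 [pick v in W | W \subset initial n v.+1].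

Lemma topE v W : v \in W -> W \subset initial n v.+1 -> top W = v.
Proof.
move=> vW Wv; rewrite /top; case: pickP => [w /andP[wW Ww]|/(_ v)].
  apply/ord_inj/eqP; rewrite eqn_leq /=.
  have := subsetP Wv w wW; have := subsetP Ww v vW; rewrite !inE !ltnS.
  by move=> -> ->.
by rewrite vW Wv.
Qed.

Lemma topP W : W != set0 -> (top W \in W) && (W \subset initial n (top W).+1).
Proof.
case/max_elt=> v vW sub; suff Wv : W \subset initial n v.+1.
  by rewrite (topE vW Wv) vW Wv.
apply/subsetP=> w wW; rewrite inE ltnS; have [-> //|wv] := eqVneq w v.
by have := subsetP sub w; rewrite !inE wv wW => /(_ isT)/ltnW.
Qed.

Definition top_cells p A : pred T := [pred x | cells p A x && (top x.1 \in x.2)].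

(** The boundary is injective on the chains all of whose cells contain the top
    vertex of W: coning with that apex kills them, so it inverts the boundary. *)
Lemma bd_rank_ge p A : (#|top_cells p A| <= bd_rank K p A)%N.
Proof.
rewrite -(dim_coord_space K (top_cells p A)) -(@limg_dim_eq _ _ _ (bd K n)).
  apply/dimvS/limgS/coord_space_sub => x /andP[Px _]; exact: point_mem.
apply/eqP; rewrite -subv0; apply/subvP=> f.
rewrite memv_cap memv_ker => /andP[/coord_spaceP f0 /eqP bf].
rewrite memv0; apply/eqP/ffunP=> -[W s]; rewrite ffunE.
have [|/f0 //] := boolP (top_cells p A (W, s)); case/andP=> _ /= ts.
have := boundary_wedge (top W) (slot f W) s.
rewrite (eq_boundary (g' := fun => 0)); last first.
  move=> t; rewrite /wedge; case: ifP => // _; rewrite /slot f0 ?mulr0 //.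
  by rewrite negb_and /= setD11 orbT.
rewrite (eq_wedge (g' := fun => 0)); last by move=> t; rewrite -bdE bf ffunE.
rewrite /wedge ts mulr0 addr0 /slot => <-; rewrite /boundary big1 // => k _.
by rewrite /contract mulr0 if_same.
Qed.

Definition cone_fun (f : V) : V := [ffun x => wedge (top x.1) (slot f x.1) x.2].

(** With v the top vertex of W and d the boundary, f and the cone v /\ d f have the
    same boundary. Passing from s to v |: s \ k replaces v by the smaller vertex
    k in W \ s, so for a shifted family the cone stays in the span. *)
Lemma bd_rank_le p L : shifted L -> (bd_rank K p L <= #|top_cells p L|)%N.
Proof.
move=> Lsh; rewrite -(dim_coord_space K (top_cells p L)).
apply: leq_trans (_ : \dim (bd K n @: coord_space K (top_cells p L)) <= _)%N; last first.
  by rewrite -[leqRHS](limg_ker_dim (bd K n)) leq_addl.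
apply: dimvS; apply/subvP=> _ /memv_imgP[f fU ->].
suff [e coneU] : bd K n f = bd K n (cone_fun (bd K n f)) /\
     cone_fun (bd K n f) \in coord_space K (top_cells p L).
  by rewrite e memv_img.
have slc g W : slot (cone_fun g) W =1 wedge (top W) (slot g W).
  by move=> t; rewrite /slot ffunE.
have slb g W : slot (bd K n g) W =1 boundary (slot g W).
  by move=> t; rewrite /slot bdE.
split.
  apply/ffunP=> -[W s]; rewrite [RHS]bdE (eq_boundary (slc _ W)).
  have := boundary_wedge (top W) (slot (bd K n f) W) s.
  rewrite (eq_wedge (g' := fun => 0)); last first.
    by move=> t; rewrite (eq_boundary (slb f W)) boundaryK.
  by rewrite /wedge mulr0 if_same addr0.
apply/coord_spaceP=> -[W s]; apply: contraNeq; rewrite ffunE /=.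
rewrite /wedge; case: ifP => ts; last by rewrite eqxx.
rewrite mulf_eq0 => /norP[_].
rewrite slb => nz.
have [k kt fk] : exists2 k, k \notin s :\ top W & f (W, k |: s :\ top W) != 0.
  apply/exists_inP; apply: contraNT nz; rewrite negb_exists_in => /forall_inP h.
  rewrite /boundary big1 // => k _; rewrite /contract; case: ifP => // /negbT /h.
  by rewrite negbK => /eqP; rewrite /slot => ->; rewrite mulr0.
have /and3P[/= sub card inL] : cells p L (W, k |: s :\ top W).
  by apply: contraNT fk => /(coord_spaceP _ _ fU) ->.
have kW : k \in W by apply: (subsetP sub); rewrite setU11.
have /andP[tW Wt] : (top W \in W) && (W \subset initial n (top W).+1).
  by apply: topP; apply/set0Pn; exists k.
apply/andP; split=> //; apply/and3P; split=> /=.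
- apply/subsetP=> z zs; have [-> //|zt] := eqVneq z (top W).
  by apply: (subsetP sub); rewrite !inE zt zs orbT.
- by move: card; rewrite cardsU1 kt (cardsD1 (top W) s) ts.
have [ke|kne] := eqVneq k (top W); first by move: inL; rewrite ke setD1K.
have ks : k \notin s by move: kt; rewrite !inE kne.
have -> : W :\: s = k |: (W :\: (k |: s :\ top W)) :\ top W.
  apply/setP=> z; rewrite !inE; have [->|zk] := eqVneq z k; first by rewrite ks kW.
  by have [->|] := eqVneq z (top W); rewrite ?ts.
apply: Lsh inL _ _ _.
- by rewrite !inE eqxx eq_sym (negPf kne) tW.
- by rewrite !inE eqxx.
- have := subsetP Wt k kW; rewrite inE ltnS leq_eqVlt => /orP[/eqP/ord_inj e|//].
  by rewrite e eqxx in kne.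
Qed.

(** Let v be the top vertex of W, with v in s. Then W \ s is a member of A below v,
    and s without v is any set of p elements below v that avoids it. *)
Lemma card_top_cells p d A : uniform d A ->
  #|top_cells p.+1 A| = (\sum_(v < n) #|inside v A| * 'C(v - d, p))%N.
Proof.
move=> Au.
rewrite -sum1_card (partition_big (fun x : T => (top x.1, x.1 :\: x.2))
  (fun y => y.2 \in inside y.1 A)) /=; last first.
  move=> [W s] /andP[/and3P[/= sub card inA] ts]; rewrite inE inA /=.
  have /andP[tW Wt] : (top W \in W) && (W \subset initial n (top W).+1).
    by apply: topP; apply/set0Pn; exists (top W); apply: (subsetP sub).
  by rewrite sub_initialS ?inE ?ts //; apply: subset_trans Wt; apply: subsetDl.
rewrite -(pair_big_dep xpredT (fun (v : 'I_n) s => s \in inside v A)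
  (fun v sg => \sum_(x | top_cells p.+1 A x && ((top x.1, x.1 :\: x.2) == (v, sg))) 1)%N) /=.
apply: eq_bigr => v _; rewrite -sum_nat_const; apply: eq_bigr => sg.
rewrite inE => /andP[sgA sgv]; rewrite sum1_card.
have vsg : v \notin sg by apply/negP=> /(subsetP sgv); rewrite inE ltnn.
have ground : #|initial n v :\: sg| = (v - d)%N.
  rewrite cardsD (setIidPr sgv) (Au sg sgA); congr (_ - _)%N.
  rewrite -sum1_card (eq_bigl (fun x : 'I_n => x < v)%N); last by move=> x; rewrite inE.
  by rewrite (big_ord_narrow (ltnW (ltn_ord v))) sum1_card card_ord.
rewrite -ground -cards_draws.
pose F (t : {set 'I_n}) := ((v |: t) :|: sg, v |: t).
have nv (t : {set 'I_n}) : t \subset initial n v :\: sg -> v \notin t.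
  by move=> h; apply/negP=> /(subsetP h); rewrite !inE ltnn andbF.
rewrite -(@card_in_imset _ _ F); last first.
  move=> t t'; rewrite !inE => /andP[/nv vt _] /andP[/nv vt' _] [_ e].
  by rewrite -(setU1K vt) e setU1K.
apply: eq_card => -[W s]; apply/idP/imsetP.
  case/andP=> /andP[/and3P[/= sub card inA] ts] /eqP[ev esg].
  rewrite ev in ts; exists (s :\ v); last first.
    by rewrite /F setD1K // -esg; congr (_, _); rewrite -{1}(setID W s) (setIidPr sub).
  rewrite inE; apply/andP; split; last first.
    by move: card; rewrite (cardsD1 v s) ts eqSS.
  apply/subsetP=> z; rewrite -esg !inE => /andP[zv zs]; rewrite zs /=.
  have /andP[_ Wt] : (top W \in W) && (W \subset initial n (top W).+1).
    by apply: topP; apply/set0Pn; exists v; apply: (subsetP sub).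
  have := subsetP Wt z (subsetP sub z zs); rewrite ev inE ltnS leq_eqVlt.
  by case/orP=> // /eqP/ord_inj e; rewrite e eqxx in zv.
case=> t; rewrite inE => /andP[tsub /eqP cardt] [-> ->].
have vt := nv t tsub.
have disj : [disjoint t & sg].
  rewrite disjoint_subset; apply/subsetP=> z /(subsetP tsub).
  by rewrite !inE => /andP[].
have topv : top ((v |: t) :|: sg) = v.
  apply: topE; rewrite ?inE ?eqxx // !subUset sub1set inE ltnSn /=.
  rewrite (subset_trans sgv) ?sub_initial // andbT.
  by apply: subset_trans (subset_trans tsub (subsetDl _ _)) _; apply: sub_initial.
have diffE : ((v |: t) :|: sg) :\: (v |: t) = sg.
  apply/setP=> z; rewrite !inE; have [->|_] := eqVneq z v; first by rewrite (negPf vsg).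
  by case zt: (z \in t) => //=; rewrite (disjointFr disj zt).
apply/andP; split; last by rewrite /= topv diffE.
apply/andP; split; last by rewrite /= topv setU11.
by apply/and3P; split=> /=; rewrite ?subsetUl ?cardsU1 ?vt ?cardt ?diffE.
Qed.

Lemma card_top_cells0 A : #|top_cells 0 A| = 0%N.
Proof.
apply: eq_card0 => -[W s]; apply/negP=> /andP[/and3P[/= _ /eqP/cards0_eq -> _]].
by rewrite inE.
Qed.

End Cone.

(** Replace A by a shifted family, compare both ranks with the number of cells
    containing the top vertex, and compare these numbers term by term. *)
Lemma bd_rank_lex_le (K : fieldType) n p d (A L : {set {set 'I_n}}) : (0 < n)%N ->
  uniform d A -> uniform d L -> lex_initial n L -> (#|L| <= #|A|)%N ->
  (bd_rank K p L <= bd_rank K p A)%N.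
Proof.
move=> n_gt0 Au Lu Linit LA; pose x0 := Ordinal n_gt0.
have [B [Bu Bsh AB RB]] := exists_shifted K p Au.
apply: leq_trans RB; apply: leq_trans (bd_rank_ge K x0 p B).
apply: leq_trans (bd_rank_le K x0 p (lex_initial_shifted Linit)) _.
case: p => [|p]; first by rewrite !card_top_cells0.
rewrite !(card_top_cells _ _ (d := d)) //; apply: leq_sum => v _.
rewrite leq_mul2r; apply/orP; right.
have allin (C : {set {set 'I_n}}) : {in C, forall s : {set 'I_n}, s \subset initial n n}.
  by move=> s _; apply/subsetP=> x _; rewrite inE.
exact: (card_inside_lex_initial (leqnn n) Bu (allin B) Bsh Lu (allin L) Linit
  (leq_trans LA AB)).
Qed.

(** * Dimensions of subquotients *)

Section QuotientDim.
Variable K : fieldType.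

(** The dimension of Z / B, witnessed by a basis of Z modulo B. The spaces are
    predicates because those of the Koszul complex live in infinite-dimensional
    modules. *)
Definition quotient_dim (V : lmodType K) (Z B : V -> Prop) (r : nat) : Prop :=
  exists e : 'I_r -> V,
  [/\ forall i, Z (e i),
      forall c : 'I_r -> K, B (\sum_i c i *: e i) -> forall i, c i = 0
    & forall z, Z z -> exists c : 'I_r -> K, B (z - \sum_i c i *: e i)].

Lemma eq_quotient_dim (V : lmodType K) (Z B Z' B' : V -> Prop) r :
  (forall v, Z v <-> Z' v) -> (forall v, B v <-> B' v) ->
  quotient_dim Z B r -> quotient_dim Z' B' r.
Proof.
move=> ZZ BB [e [eZ ei es]]; exists e; split=> [i|c /BB|z /ZZ/es[c cB]].
- exact/ZZ.
- exact: ei.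
- by exists c; apply/BB.
Qed.

(** A linear relation which is total on both sides and matches B with B' induces an
    isomorphism of Z / B with Z' / B'. Zig-zags give relations directly, whereas
    a map would require choosing lifts linearly. *)
Lemma quotient_dim_transfer (V V' : lmodType K) (Z B : V -> Prop)
    (Z' B' : V' -> Prop) (rho : V -> V' -> Prop) r :
  rho 0 0 ->
  (forall a x y x' y', rho x x' -> rho y y' -> rho (a *: x + y) (a *: x' + y')) ->
  (forall x, Z x -> exists2 x', Z' x' & rho x x') ->
  (forall x', Z' x' -> exists2 x, Z x & rho x x') ->
  (forall x x', rho x x' -> (B x <-> B' x')) ->
  quotient_dim Z B r -> quotient_dim Z' B' r.
Proof.
move=> rho0 rhoD left right rhoB [e [eZ eindep espan]].
have [e' e'P] : exists e' : 'I_r -> V', forall i, Z' (e' i) /\ rho (e i) (e' i).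
  apply: (fin_all_exists (P := fun i x => Z' x /\ rho (e i) x)) => i.
  by have [x' ? ?] := left _ (eZ i); exists x'.
have sum_rho (c : 'I_r -> K) : rho (\sum_i c i *: e i) (\sum_i c i *: e' i).
  elim/big_ind2: _ => [//|x x' y y' h h'|i _].
    by rewrite -[x]scale1r -[x']scale1r; apply: rhoD.
  by rewrite -[X in rho X]addr0 -[X in rho _ X]addr0; apply: rhoD => //; case: (e'P i).
exists e'; split=> [i|c cB|z' Zz'].
- by case: (e'P i).
- by apply: eindep; apply/(rhoB _ _ (sum_rho c)).
- have [z Zz zz'] := right _ Zz'; have [c cB] := espan z Zz; exists c.
  apply/(rhoB (z - \sum_i c i *: e i)) => //.
  rewrite addrC -scaleN1r [z' - _]addrC -[X in rho _ (X + _)]scaleN1r.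
  exact: rhoD.
Qed.

(** Writing an independent family in terms of a spanning one gives a matrix with
    independent rows. *)
Lemma quotient_dim_le (V : lmodType K) (Z B : V -> Prop) r r' :
  (forall a x y, B x -> B y -> B (a *: x + y)) -> B 0 ->
  quotient_dim Z B r -> quotient_dim Z B r' -> (r' <= r)%N.
Proof.
move=> BD B0 [e [eZ _ espan]] [f [fZ findep _]].
have [c cP] : exists c : 'I_r' -> 'I_r -> K, forall k, B (f k - \sum_i c k i *: e i).
  apply: (fin_all_exists (P := fun k (c : 'I_r -> K) => B (f k - \sum_i c i *: e i))).
  by move=> k; apply: espan.
pose M : 'M[K]_(r', r) := \matrix_(k, i) c k i.
suff: row_free M by rewrite /row_free => /eqP <-; apply: rank_leq_col.

apply: inj_row_free => v vM.
have combo : B (\sum_k v 0 k *: (f k - \sum_i c k i *: e i)).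
  elim/big_ind: _ => [//|x y Bx By|k _].
    by rewrite -[x]scale1r; apply: BD.
  by rewrite -[X in B X]addr0; apply: BD.
apply/rowP=> k; rewrite mxE; apply: findep k.
suff -> : \sum_k v 0 k *: f k = \sum_k v 0 k *: (f k - \sum_i c k i *: e i) by [].
under [RHS]eq_bigr => k _ do rewrite scalerBr.
rewrite sumrB; under [X in _ - X]eq_bigr => k _ do rewrite scaler_sumr.
rewrite exchange_big /= [X in _ - X]big1 ?subr0 // => i _.
under eq_bigr => k _ do rewrite scalerA.
rewrite -scaler_suml; have /rowP/(_ i) := vM; rewrite !mxE.
by under eq_bigr => k _ do rewrite mxE; move=> ->; rewrite scale0r.
Qed.

Lemma quotient_dim_mx n m1 m2 (Z : 'M[K]_(m1, n)) (B : 'M[K]_(m2, n)) :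
  quotient_dim (fun v : 'rV_n => (v <= Z)%MS) (fun v => (v <= B)%MS)
    (\rank (Z :\: B)%MS).
Proof.
set Q := (Z :\: B)%MS; pose E := row_base Q.
have sumE (c : 'I_(\rank Q) -> K) : \sum_i c i *: row i E = (\row_i c i) *m E.
  by rewrite mulmx_sum_row; apply: eq_bigr => i _; rewrite mxE.
exists (fun i => row i E); split=> [i|c|z zZ].
- apply: submx_trans (row_sub i E) _; rewrite (eq_row_base Q).
  exact: diffmxSl.
- rewrite sumE => inB i.
  have : ((\row_i c i) *m E <= Q :&: B)%MS.
    by rewrite sub_capmx inB andbT (submx_trans (submxMl _ _)) ?eq_row_base.
  rewrite capmx_diff submx0 => /eqP e0.
  have /rowP/(_ i) : (\row_i c i) = 0.
    by apply: (row_free_inj (row_base_free Q)); rewrite mul0mx.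
  by rewrite !mxE.
- have : (z <= Q + B)%MS.
    apply: submx_trans zZ _; rewrite -(addsmx_diff_cap_eq Z B).
    by rewrite addsmxS ?capmxSr.
  case/sub_addsmxP=> -[u1 u2] /= ->.
  have : (u1 *m Q <= E)%MS by rewrite eq_row_base submxMl.
  case/submxP=> w ->; exists (fun i => w 0 i); rewrite sumE.
  rewrite (_ : \row_i w 0 i = w); last by apply/rowP=> i; rewrite mxE.
  by rewrite addrC addKr submxMl.
Qed.

Lemma quotient_dim_vspace (V : vectType K) (Z B : {vspace V}) : (B <= Z)%VS ->
  quotient_dim (fun v => v \in Z) (fun v => v \in B) (\dim Z - \dim B).
Proof.
move=> BZ; set Q := (Z :\: B)%VS.
have dQ : (\dim Z - \dim B = \dim Q)%N.
  by rewrite -(dimv_cap_compl Z B) (capv_idPr BZ) addKn.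
rewrite dQ; exists (fun i => (vbasis Q)`_i); split=> [i|c inB i|z zZ].
- apply: (subvP (diffvSl Z B)); apply: vbasis_mem; apply: mem_nth.
  by rewrite size_tuple.
- have : \sum_i c i *: (vbasis Q)`_i \in (Q :&: B)%VS.
    rewrite memv_cap inB andbT; apply: memv_suml => k _; apply: memvZ.
    by apply: vbasis_mem; apply: mem_nth; rewrite size_tuple.
  rewrite capv_diff memv0 => /eqP e0.
  have /freeP := basis_free (vbasisP Q); exact.
- have : z \in (Q + B)%VS.
    by apply: subvP zZ; rewrite -{1}(addv_diff_cap Z B) addvS ?capvSr.
  case/memv_addP=> q qQ [b bB ->].
  exists (fun i => coord (vbasis Q) i q); rewrite -(coord_vbasis qQ).
  by rewrite addrC addKr.
Qed.

End QuotientDim.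

(** * The Koszul complex and its multidegrees *)

Section Polynomials.
Variables (K : fieldType) (n : nat).
Notation S := {mpoly K[n]}.
Implicit Types (p q : S) (m a : 'X_{1..n}) (s t : {set 'I_n}) (k : 'I_n).

Lemma mcoeffXM k p m : ('X_k * p)@_m = if (0 < m k)%N then p@_(m - U_(k)) else 0.
Proof.
rewrite mulrC; case: ifP => [mk|/negbT mk].
  by rewrite -{1}(@submK _ U_(k) m) ?lep1mP -?lt0n // addmC mcoeffMX.
apply: memN_msupp_eq0; rewrite (perm_mem (msuppMX _ _)).
by apply: contra mk => /mapP[m' _ ->]; rewrite mnmDE mnm1E eqxx.
Qed.

Definition sqfree s : 'X_{1..n} := [multinom (k \in s : nat) | k < n].

Lemma sqfreeE s k : sqfree s k = (k \in s). Proof. exact: mnmE. Qed.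

Lemma sqfree_le s a : reflect (forall k, k \in s -> 0 < a k)%N (sqfree s <= a)%MM.
Proof.
apply: (iffP mnm_lepP) => h k; have := h k; rewrite sqfreeE; first by move=> + ks; rewrite ks.
by case: (k \in s) => // ->.
Qed.

Lemma mdeg_sqfree s : mdeg (sqfree s) = #|s|.
Proof.
rewrite mdegE -sum1_card [RHS]big_mkcond; apply: eq_bigr => k _.
by rewrite sqfreeE; case: (k \in s).
Qed.

Lemma sqfree0 : sqfree set0 = 0%MM.
Proof. by apply/mnmP=> k; rewrite sqfreeE inE mnm0E. Qed.

Lemma sqfreeU1 k s : k \notin s -> sqfree (k |: s) = (sqfree s + U_(k))%MM.
Proof.
move=> ks; apply/mnmP=> l; rewrite mnmDE mnm1E !sqfreeE !inE eq_sym addnC.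
by case: (k =P l) => [<-|] //; rewrite (negPf ks).
Qed.

(** The degree is an integer because shifts of graded free modules may make it
    negative; the component is then zero. *)
Definition degree_component (d : int) p : S :=
  \sum_(m <- msupp p | (mdeg m)%:Z == d) p@_m *: 'X_[m].

Lemma mcoeff_degree_component d p m :
  (degree_component d p)@_m = if (mdeg m)%:Z == d then p@_m else 0.
Proof.
rewrite raddf_sum /= (eq_bigr (fun m' => p@_m' * (m' == m)%:R)); last first.
  by move=> m' _; rewrite mcoeffZ mcoeffX.
have [mp|mp] := boolP (m \in msupp p); last first.
  rewrite (memN_msupp_eq0 mp) if_same big_seq_cond big1 // => m' /andP[m'p _].
  by case: eqP => [e|_]; rewrite ?mulr0 // e (negPf mp) in m'p *.
rewrite big_mkcond (bigD1_seq m) ?msupp_uniq //= eqxx mulr1 big1 ?addr0 // => m' ne.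
by rewrite (negPf ne) mulr0 if_same.
Qed.

Lemma degree_component_is_linear d : linear (degree_component d).
Proof.
move=> a p q; apply/mpolyP=> m; rewrite mcoeffD mcoeffZ !mcoeff_degree_component.
by rewrite mcoeffD mcoeffZ; case: ifP; rewrite ?mulr0 ?addr0.
Qed.

HB.instance Definition _ d :=
  GRing.isLinear.Build K S S _ (degree_component d) (degree_component_is_linear d).

Lemma degree_component_id d p : degree_component d (degree_component d p) = degree_component d p.
Proof. by apply/mpolyP=> m; rewrite !mcoeff_degree_component; case: ifP => // ->. Qed.

Lemma degree_component_homog d e q : homog_of_degree e q ->
  degree_component d q = if e == d then q else 0.
Proof.
move=> qe; apply/mpolyP=> m; rewrite mcoeff_degree_component.
have [q0|qm] := eqVneq q@_m 0; first by rewrite !fun_if q0 mcoeff0 !if_same.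
by rewrite (qe m) ?mcoeff_msupp //; case: ifP; rewrite ?mcoeff0.
Qed.

Lemma homog_mulX m e q : homog_of_degree e q ->
  homog_of_degree ((mdeg m)%:Z + e) ('X_[m] * q).
Proof.
move=> qe m'; rewrite mulrC (perm_mem (msuppMX _ _)) => /mapP[m2 /qe <- ->].
by rewrite mdegD PoszD.
Qed.

Lemma degree_componentM d e p q : homog_of_degree e q ->
  degree_component (d + e) (p * q) = degree_component d p * q.
Proof.
move=> qe; rewrite (mpolyE p) mulr_suml !linear_sum /= mulr_suml.
apply: eq_bigr => m _; rewrite -scalerAl !linearZ /= -scalerAl; congr (_ *: _).
rewrite (degree_component_homog _ (@homog_mulX m e q qe)).
rewrite (@degree_component_homog d (mdeg m)%:Z); last by move=> m'; rewrite msuppX inE => /eqP ->.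
by rewrite (inj_eq (addIr _)); case: ifP => // _; rewrite mul0r.
Qed.

End Polynomials.

Section Chains.
Variables (K : fieldType) (n : nat).
Notation S := {mpoly K[n]}.
Notation chain r := {ffun {set 'I_n} * 'I_r -> S}.
Implicit Types (a m : 'X_{1..n}) (s t : {set 'I_n}) (k : 'I_n).

(** A chain c of the Koszul complex on a free module of rank r is the sum of the
    c (s, b) e_s (x) e_b, over all homological degrees #|s| at once. *)
Definition koszul r (c : chain r) : chain r := [ffun x : {set 'I_n} * 'I_r =>
  \sum_(k < n) if k \in x.1 then 0 else ext_sign K k x.1 *: ('X_k * c (k |: x.1, x.2))].

Definition mulmx_chain r r' (M : 'M[S]_(r, r')) (c : chain r) : chain r' :=
  [ffun x : {set 'I_n} * 'I_r' => \sum_b c (x.1, b) * M b x.2].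

Lemma koszul_is_linear r : linear (@koszul r).
Proof.
move=> u c c'; apply/ffunP=> x; rewrite !ffunE scaler_sumr -big_split.
apply: eq_bigr => k _ /=; case: ifP => _; rewrite ?scaler0 ?addr0 // !ffunE.
by rewrite mulrDr scalerDr -scalerAr !scalerA mulrC.
Qed.

HB.instance Definition _ r := GRing.isLinear.Build K (chain r) (chain r) _ (@koszul r) (@koszul_is_linear r).

Lemma mulmx_chain_is_linear r r' (M : 'M_(r, r')) : linear (mulmx_chain M).
Proof.
move=> u c c'; apply/ffunP=> x; rewrite !ffunE scaler_sumr -big_split.
by apply: eq_bigr => b _; rewrite !ffunE mulrDl -scalerAl.
Qed.

HB.instance Definition _ r r' (M : 'M_(r, r')) :=
  GRing.isLinear.Build K (chain r) (chain r') _ (mulmx_chain M) (mulmx_chain_is_linear M).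

Lemma koszul_mulmx r r' (M : 'M_(r, r')) c : koszul (mulmx_chain M c) = mulmx_chain M (koszul c).
Proof.
apply/ffunP=> -[t b]; rewrite !ffunE /=.
under [RHS]eq_bigr => e _ do rewrite ffunE /= mulr_suml.
rewrite [RHS]exchange_big; apply: eq_bigr => k _ /=.
case: ifP => _; first by rewrite big1 // => e _; rewrite mul0r.
rewrite ffunE /= mulr_sumr scaler_sumr; apply: eq_bigr => e _.
by rewrite mulrA -scalerAl.
Qed.

(** The part of multidegree a: the coefficient at x^(a - s) e_s. Since multiplying
    by x_k exactly compensates removing k from s, the Koszul differential
    becomes the simplicial boundary on the subsets of the support of a. *)
Definition slice r (c : chain r) a (b : 'I_r) : {set 'I_n} -> K := fun s =>
  if (sqfree s <= a)%MM then (c (s, b))@_(a - sqfree s) else 0.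

Lemma slice_inj r (c c' : chain r) :
  (forall a b, slice c a b =1 slice c' a b) -> c = c'.
Proof.
move=> h; apply/ffunP=> -[s b]; apply/mpolyP=> m.
by have := h (m + sqfree s)%MM b s; rewrite /slice lem_addl addmK.
Qed.

Lemma sqfree_leU1 k s a : k \notin s ->
  (sqfree (k |: s) <= a)%MM = (sqfree s <= a)%MM && (0 < a k)%N.
Proof.
move=> ks; apply/sqfree_le/andP=> [h|[/sqfree_le h ak] l].
  by split; [apply/sqfree_le=> l ls; apply: h; rewrite !inE ls orbT|apply: h; rewrite setU11].
by rewrite !inE => /orP[/eqP -> //|/h].
Qed.

Lemma slice_koszul r (c : chain r) a b : slice (koszul c) a b =1 boundary (slice c a b).
Proof.
move=> t; rewrite /slice /boundary; case: ifP => ta; last first.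
  rewrite big1 // => k _; rewrite /contract; case: ifP => // /negbT kt.
  by rewrite sqfree_leU1 // ta mulr0.
rewrite ffunE raddf_sum; apply: eq_bigr => k _ /=.
rewrite /contract; case: ifP => [|/negbT kt]; first by rewrite mcoeff0.
rewrite mcoeffZ mcoeffXM mnmBE sqfreeE (negPf kt) subn0 sqfree_leU1 // ta /=.
by rewrite sqfreeU1 // submDA.
Qed.

Lemma koszulK r (c : chain r) : koszul (koszul c) = 0.
Proof.
apply: slice_inj => a b s; rewrite slice_koszul (eq_boundary (slice_koszul c a b)).
by rewrite boundaryK /slice ffunE mcoeff0 if_same.
Qed.

(** A family of multigraded parts comes from a chain when only finitely many of them
    are nonzero; As lists their multidegrees. *)
Definition unslice r (As : seq 'X_{1..n}) (h : 'X_{1..n} -> 'I_r -> {set 'I_n} -> K) : chain r :=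
  [ffun x : {set 'I_n} * 'I_r => \sum_(a <- As | (sqfree x.1 <= a)%MM) h a x.2 x.1 *: 'X_[a - sqfree x.1]].

Lemma slice_unslice r As (h : 'X_{1..n} -> 'I_r -> {set 'I_n} -> K) a b s :
  uniq As ->
  slice (unslice As h) a b s = if (a \in As) && (sqfree s <= a)%MM then h a b s else 0.
Proof.
move=> Au; rewrite /slice andbC; case: ifP => // sa; rewrite ffunE raddf_sum /=.
rewrite (eq_bigr (fun a' => h a' b s * ((a' - sqfree s)%MM == (a - sqfree s)%MM)%:R)); last first.
  by move=> a' _; rewrite mcoeffZ mcoeffX.
have sub_eq a' : (sqfree s <= a')%MM -> ((a' - sqfree s)%MM == (a - sqfree s)%MM) = (a' == a).
  by move=> sa'; apply/eqP/eqP=> [e|-> //]; rewrite -(submK sa') e submK.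
case: ifP => [aA|aA].
  rewrite big_mkcond (bigD1_seq a) //= sa eqxx mulr1 big1 ?addr0 // => a' ne.
  by case: ifP => // /sub_eq ->; rewrite (negPf ne) mulr0.
rewrite big_seq_cond big1 // => a' /andP[a'A sa']; rewrite sub_eq //.
by case: eqP => [e|_]; rewrite ?mulr0 //; rewrite e aA in a'A.
Qed.

Definition multidegrees r (c : chain r) : seq 'X_{1..n} :=
  undup (flatten [seq [seq (m + sqfree x.1)%MM | m <- msupp (c x)] | x <- enum {: {set 'I_n} * 'I_r}]).

Lemma slice_out r (c : chain r) a b s : a \notin multidegrees c -> slice c a b s = 0.
Proof.
rewrite mem_undup => h; rewrite /slice; case: ifP => // sa; apply: memN_msupp_eq0.
apply: contra h => h; apply/flatten_mapP; exists (s, b); first by rewrite mem_enum.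
by apply/mapP; exists (a - sqfree s)%MM; rewrite // submK.
Qed.

(** Each multidegree a is coned with its own apex kappa a, which is possible when
    x_(kappa a) divides x^a. The parts of the primitive are described since an
    ideal may have to contain them. *)
Lemma koszul_homotopy r (c : chain r) (kappa : 'X_{1..n} -> 'I_n) :
  koszul c = 0 ->
  (forall a b s, slice c a b s != 0 -> (0 < a (kappa a))%N) ->
  exists2 d, koszul d = c & forall a b, slice d a b =1 wedge (kappa a) (slice c a b).
Proof.
move=> c0 kpos; pose d := unslice (multidegrees c) (fun a b => wedge (kappa a) (slice c a b)).
have dE a b : slice d a b =1 wedge (kappa a) (slice c a b).
  move=> s; rewrite slice_unslice ?undup_uniq //; case: ifP => // h.
  rewrite /wedge; case: ifP => // ks.
  have [->|nz] := eqVneq (slice c a b (s :\ kappa a)) 0; first by rewrite mulr0.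
  have aA : a \in multidegrees c.
    by apply: contraNT nz => aA; rewrite slice_out.
  move: h; rewrite aA /= -(setD1K ks) sqfree_leU1 ?setD11 // (kpos a b _ nz) andbT.
  by move: nz; rewrite /slice; case: ifP => //; rewrite eqxx.
exists d => //; apply: slice_inj => a b s; rewrite slice_koszul (eq_boundary (dE a b)).
have := boundary_wedge (kappa a) (slice c a b) s.
rewrite (eq_wedge (g' := fun => 0)); last first.
  by move=> t; rewrite -slice_koszul c0 /slice ffunE mcoeff0 if_same.
by rewrite [X in _ + X](_ : _ = 0) ?addr0 // /wedge mulr0 if_same.
Qed.

(** Homological degree p and internal degree j, where g b is the degree of the
    b-th basis element and e_s has degree #|s|. *)
Definition graded_part r (g : 'I_r -> int) (p : nat) (j : int) (c : chain r) : chain r :=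
  [ffun x : {set 'I_n} * 'I_r => if #|x.1| == p then degree_component (j - p%:Z - g x.2) (c x) else 0].

Lemma graded_part_is_linear r g p j : linear (@graded_part r g p j).
Proof.
move=> u c c'; apply/ffunP=> x; rewrite !ffunE; case: ifP => _; first by rewrite linearP.
by rewrite scaler0 addr0.
Qed.

HB.instance Definition _ r g p j := GRing.isLinear.Build K (chain r) (chain r) _
  (@graded_part r g p j) (@graded_part_is_linear r g p j).

Definition graded r g p j (c : chain r) := graded_part g p j c = c.

Lemma graded_part_graded r g p j (c : chain r) : graded g p j (graded_part g p j c).
Proof.
by apply/ffunP=> x; rewrite !ffunE; case: ifP => // ->; rewrite degree_component_id.
Qed.

Lemma gradedP r g p j (c : chain r) :
  graded g p j c <-> forall s b m, (c (s, b))@_m != 0 ->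
    #|s| = p /\ (mdeg m)%:Z + p%:Z + g b = j.
Proof.
split=> [h s b m|h].
  have := congr1 (fun f : chain r => (f (s, b))@_m) h; rewrite ffunE /= => <-.
  case: ifP => [/eqP sp|_]; last by rewrite mcoeff0 eqxx.
  rewrite mcoeff_degree_component; case: ifP => [/eqP -> _|]; last by rewrite eqxx.
  by split=> //; lia.
apply/ffunP=> -[s b]; rewrite ffunE /=; apply/mpolyP=> m.
have [c0|/h[sp e]] := eqVneq (c (s, b))@_m 0.
  by rewrite c0; case: ifP => _; rewrite ?mcoeff0 // mcoeff_degree_component c0 if_same.
by rewrite sp eqxx mcoeff_degree_component ifT //; apply/eqP; lia.
Qed.

Lemma homogX k : homog_of_degree 1 ('X_k : S).
Proof. by move=> m; rewrite msuppX inE => /eqP ->; rewrite mdeg1. Qed.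

Lemma graded_part_koszul r g p j (c : chain r) :
  graded_part g p j (koszul c) = koszul (graded_part g p.+1 j c).
Proof.
apply/ffunP=> -[s b]; rewrite !ffunE /=; case: ifP => sp.
  rewrite linear_sum; apply: eq_bigr => k _; case: ifP => [_|/negbT ks]; first by rewrite linear0.
  rewrite linearZ /= ffunE /= cardsU1 ks (eqP sp) eqxx; congr (_ *: _).
  rewrite mulrC [RHS]mulrC -(degree_componentM _ _ (@homogX k)); congr degree_component.
  by rewrite intS; lia.
rewrite big1 // => k _; case: ifP => // /negbT ks.
by rewrite ffunE /= cardsU1 ks eqSS sp mulr0 scaler0.
Qed.

Lemma graded_part_mulmx r r' (g : 'I_r -> int) (g' : 'I_r' -> int) p j (M : 'M_(r, r')) c :
  (forall b b', homog_of_degree (g b - g' b') (M b b')) ->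
  graded_part g' p j (mulmx_chain M c) = mulmx_chain M (graded_part g p j c).
Proof.
move=> Mh; apply/ffunP=> -[s b']; rewrite !ffunE /=; case: ifP => sp; last first.
  by rewrite big1 // => b _; rewrite ffunE /= sp mul0r.
rewrite linear_sum; apply: eq_bigr => b _ /=.
rewrite ffunE /= sp -(degree_componentM _ _ (Mh b b')); congr degree_component; ring.
Qed.

Lemma graded_linear r g p j u (c d : chain r) :
  graded g p j c -> graded g p j d -> graded g p j (u *: c + d).
Proof. by move=> gc gd; rewrite /graded linearD linearZ /= gc gd. Qed.

Lemma graded_koszul r g p j (c : chain r) : graded g p.+1 j c -> graded g p j (koszul c).
Proof. by rewrite /graded graded_part_koszul => ->. Qed.

(** Any variable dividing x^a can serve as apex, so only multidegree 0 carries
    homology: the constants in homological degree 0. *)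
Lemma koszul_acyclic r g p j (c : chain r) : (0 < n)%N ->
  graded g p j c -> koszul c = 0 -> (forall b, (c (set0, b))@_0 = 0) ->
  exists2 d, graded g p.+1 j d & c = koszul d.
Proof.
move=> n_gt0 gc c0 cst0; pose x0 := Ordinal n_gt0.
pose kappa (a : 'X_{1..n}) := odflt x0 [pick k | (0 < a k)%N].
have [|d dc _] := koszul_homotopy (kappa := kappa) c0.
  move=> a b s; rewrite /kappa; case: pickP => [//|a0]; apply: contraNT => _.
  have {a0} -> : a = 0%MM.
    by apply/mnmP=> k; rewrite mnm0E; have := a0 k; case: (a k).
  rewrite /slice; case: ifP => // /sqfree_le s0.
  have -> : s = set0.
    by apply/setP=> k; rewrite inE; apply/negP=> /s0; rewrite mnm0E.
  by rewrite sqfree0 subm0 cst0.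
exists (graded_part g p.+1 j d); first exact: graded_part_graded.
by rewrite -graded_part_koszul dc gc.
Qed.

End Chains.

(** * Zig-zags between a resolution and the Koszul complex *)

Section Balancing.
Variables (K : fieldType) (n : nat).
Hypothesis n_gt0 : (0 < n)%N.
Notation S := {mpoly K[n]}.
Notation chain r := {ffun {set 'I_n} * 'I_r -> S}.

Definition homog_mx r r' (g : 'I_r -> int) (g' : 'I_r' -> int) (M : 'M[S]_(r, r')) :=
  forall b b', homog_of_degree (g b - g' b') (M b b').

Definition image_chain r r' (M : 'M[S]_(r, r')) (c : chain r') :=
  exists x : chain r, c = mulmx_chain M x.

Definition exact_at r r' r'' (M : 'M[S]_(r, r')) (M' : 'M[S]_(r', r'')) :=
  forall c : chain r', mulmx_chain M' c = 0 <-> image_chain M c.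

Definition koszul_cycles r (g : 'I_r -> int) (N : chain r -> Prop) p j (c : chain r) :=
  [/\ graded g p j c, N c & koszul c = 0].

Definition koszul_boundaries r (g : 'I_r -> int) (N : chain r -> Prop) p j (c : chain r) :=
  exists d, [/\ graded g p.+1 j d, N d & c = koszul d].

(** Reduction modulo the variables, in homological degree 0. *)
Definition const_part r (c : chain r) : 'rV[K]_r := \row_b (c (set0, b))@_0.

Definition const_chain r (z : 'rV[K]_r) : chain r :=
  [ffun x : {set 'I_n} * 'I_r => if x.1 == set0 then (z 0 x.2)%:MP else 0].

Lemma const_part_is_linear r : linear (@const_part r).
Proof. by move=> u c d; apply/rowP=> b; rewrite !mxE !ffunE mcoeffD mcoeffZ. Qed.

HB.instance Definition _ r := GRing.isLinear.Build K (chain r) 'rV[K]_r _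
  (@const_part r) (@const_part_is_linear r).

Lemma const_chainK r (z : 'rV[K]_r) : const_part (const_chain z) = z.
Proof. by apply/rowP=> b; rewrite mxE ffunE /= eqxx mcoeffC eqxx mulr1. Qed.

Lemma const_part_mulmx r r' (M : 'M[S]_(r, r')) (c : chain r) :
  const_part (mulmx_chain M c) = const_part c *m map_mx (mcoeff 0%MM) M.
Proof.
apply/rowP=> b; rewrite !mxE ffunE rmorph_sum; apply: eq_bigr => e _ /=.
by rewrite !mxE rmorphM.
Qed.

Lemma const_part_koszul r (c : chain r) : const_part (koszul c) = 0.
Proof.
apply/rowP=> b; rewrite !mxE ffunE raddf_sum big1 //= => k _.
by rewrite inE mcoeffZ mcoeffXM mnm0E mulr0.
Qed.

Definition in_degree r (g : 'I_r -> int) j (z : 'rV[K]_r) := forall b, z 0 b != 0 -> g b = j.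

Lemma graded_const_chain r (g : 'I_r -> int) j z : in_degree g j z -> graded g 0 j (const_chain z).
Proof.
move=> zj; apply/gradedP=> s b m; rewrite ffunE /=.
case: (s =P set0) => [->|_]; last by rewrite mcoeff0 eqxx.
rewrite mcoeffC; case: (m =P 0%MM) => [->|_]; last by rewrite mulr0 eqxx.
by rewrite mulr1 cards0 mdeg0 => /zj ->; rewrite !add0r.
Qed.

Lemma in_degree_const_part r (g : 'I_r -> int) j (c : chain r) :
  graded g 0 j c -> in_degree g j (const_part c).
Proof. by move/gradedP=> gc b; rewrite mxE => /gc[_]; rewrite mdeg0 !add0r. Qed.

Lemma graded_mulmx r r' (g : 'I_r -> int) (g' : 'I_r' -> int) p j (M : 'M[S]_(r, r')) c :
  homog_mx g g' M -> graded g p j c -> graded g' p j (mulmx_chain M c).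
Proof. by move=> Mh gc; rewrite /graded (graded_part_mulmx p j c Mh) gc. Qed.

(** A preimage can be replaced by its homogeneous part, the maps being homogeneous. *)
Lemma graded_lift r r' (g : 'I_r -> int) (g' : 'I_r' -> int) p j (M : 'M[S]_(r, r')) c :
  homog_mx g g' M -> graded g' p j c -> image_chain M c ->
  exists2 x, graded g p j x & c = mulmx_chain M x.
Proof.
move=> Mh gc [x cx]; exists (graded_part g p j x); first exact: graded_part_graded.
by rewrite -(graded_part_mulmx p j x Mh) -cx gc.
Qed.

Lemma koszul_lift r (g : 'I_r -> int) p j (c : chain r) :
  graded g p j c -> koszul c = 0 -> const_part c = 0 ->
  exists2 d, graded g p.+1 j d & c = koszul d.
Proof.
move=> gc c0 cst; apply: koszul_acyclic => // b.
by have /rowP/(_ b) := cst; rewrite !mxE.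
Qed.

Lemma const_part_pos r (g : 'I_r -> int) p j (c : chain r) :
  graded g p.+1 j c -> const_part c = 0.
Proof.
move/gradedP=> gc; apply/rowP=> b; rewrite !mxE; apply/eqP; apply: contraTT isT.
by move/gc=> []; rewrite cards0.
Qed.

Lemma gradedB r (g : 'I_r -> int) p j (c d : chain r) :
  graded g p j c -> graded g p j d -> graded g p j (c - d).
Proof. by rewrite addrC -scaleN1r => gc gd; apply: graded_linear. Qed.

Lemma graded0 r (g : 'I_r -> int) p j : graded g p j (0 : chain r).
Proof. by rewrite /graded linear0. Qed.

Lemma koszul_deg0 r (g : 'I_r -> int) j (c : chain r) : graded g 0 j c -> koszul c = 0.
Proof.
move/gradedP=> gc; apply/ffunP=> -[s b]; rewrite !ffunE big1 // => k _ /=.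
case: ifP => // ks; suff -> : c (k |: s, b) = 0 by rewrite mulr0 scaler0.
apply/mpolyP=> m; rewrite mcoeff0; apply/eqP; apply: contraTT isT => /gc[].
by rewrite cardsU1 ks.
Qed.

(** The connecting isomorphism for 0 -> im M -> S^r' -> im M' -> 0. The middle
    term is Koszul acyclic in positive degrees, so an element x of the
    middle term links d x in im M with M' x in im M'. *)
Lemma koszul_connecting r r' r'' (g : 'I_r -> int) (g' : 'I_r' -> int) (g'' : 'I_r'' -> int)
    (M : 'M[S]_(r, r')) (M' : 'M[S]_(r', r'')) p j d :
  homog_mx g g' M -> homog_mx g' g'' M' -> exact_at M M' ->
  quotient_dim (koszul_cycles g' (image_chain M) p.+1 j)
               (koszul_boundaries g' (image_chain M) p.+1 j) d ->
  quotient_dim (koszul_cycles g'' (image_chain M') p.+2 j)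
               (koszul_boundaries g'' (image_chain M') p.+2 j) d.
Proof.
move=> Mh Mh' ex.
apply: (quotient_dim_transfer (rho := fun c c' =>
  exists x, [/\ graded g' p.+2 j x, c = koszul x & c' = mulmx_chain M' x])).
- by exists 0; split; rewrite ?linear0 //; apply: graded0.
- move=> u x y x' y' [c [gc -> ->]] [c' [gc' -> ->]]; exists (u *: c + c').
  by split; rewrite ?linearD ?linearZ //; apply: graded_linear.
- move=> c [gc /ex Nc c0]; have [x gx cx] := koszul_lift gc c0 (const_part_pos gc).
  exists (mulmx_chain M' x); last by exists x.
  split; [exact: graded_mulmx Mh' gx | by exists x | by rewrite koszul_mulmx -cx].
- move=> c' [gc' Nc' c0]; have [x gx cx] := graded_lift Mh' gc' Nc'.
  exists (koszul x); last by exists x.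
  split; [exact: graded_koszul | apply/ex; by rewrite -koszul_mulmx -cx | exact: koszulK].
- move=> _ _ [x [gx -> ->]]; split=> [[y [gy /ex Ny xy]]|[y' [gy' Ny' xy']]].
    have [||u gu xu] := koszul_lift (gradedB gx gy).
    + by rewrite linearB /= xy subrr.
    + by apply: const_part_pos (gradedB gx gy).
    exists (mulmx_chain M' u); split; [exact: graded_mulmx Mh' gu | by exists u |].
    by rewrite koszul_mulmx -xu linearB /= Ny subr0.
  have [y gy yy] := graded_lift Mh' gy' Ny'.
  exists (x - koszul y); split.
  + exact: gradedB gx (graded_koszul gy).
  + by apply/ex; rewrite linearB /= -koszul_mulmx -yy xy' subrr.
  + by rewrite linearB /= koszulK subr0.
Qed.

(** The homology of K (x) F in degree 0 is I / (x_1, ..., x_n) I: an element of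
    F_0 is reduced modulo the variables on one side and mapped to I on the
    other. *)
Lemma tor0_koszul r r' r'' (g : 'I_r -> int) (g' : 'I_r' -> int) (g'' : 'I_r'' -> int)
    (M : 'M[S]_(r, r')) (M' : 'M[S]_(r', r'')) j d :
  homog_mx g g' M -> homog_mx g' g'' M' -> exact_at M M' ->
  quotient_dim (in_degree g' j)
    (fun z => exists2 w, in_degree g j w & z = w *m map_mx (mcoeff 0%MM) M) d ->
  quotient_dim (koszul_cycles g'' (image_chain M') 0 j)
               (koszul_boundaries g'' (image_chain M') 0 j) d.
Proof.
move=> Mh Mh' ex.
apply: (quotient_dim_transfer (rho := fun z c' =>
  exists x, [/\ graded g' 0 j x, z = const_part x & c' = mulmx_chain M' x])).
- by exists 0; split; rewrite ?linear0 //; apply: graded0.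
- move=> u x y x' y' [c [gc -> ->]] [c' [gc' -> ->]]; exists (u *: c + c').
  by split; rewrite ?linearD ?linearZ //; apply: graded_linear.
- move=> z zj; have gz := graded_const_chain zj.
  exists (mulmx_chain M' (const_chain z)); last by exists (const_chain z); rewrite const_chainK.
  have gM := graded_mulmx Mh' gz.
  by split=> //; [exists (const_chain z) | apply: koszul_deg0 gM].
- move=> c' [gc' Nc' _]; have [x gx cx] := graded_lift Mh' gc' Nc'.
  by exists (const_part x); [apply: in_degree_const_part | exists x].
- move=> _ _ [x [gx -> ->]]; split=> [[w wj xw]|[y' [gy' Ny' xy']]].
    have gw := graded_mulmx Mh (graded_const_chain wj).
    have gxw := gradedB gx gw.
    have [||y gy xy] := koszul_lift gxw.
    + exact: koszul_deg0 gxw.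
    + by rewrite linearB /= const_part_mulmx const_chainK xw subrr.
    exists (mulmx_chain M' y); split; [exact: graded_mulmx Mh' gy | by exists y |].
    rewrite koszul_mulmx -xy linearB /= (_ : mulmx_chain M' (mulmx_chain M _) = 0) ?subr0 //.
    by apply/ex; exists (const_chain w).
  have [y gy yy] := graded_lift Mh' gy' Ny'.
  have im : image_chain M (x - koszul y).
    by apply/ex; rewrite linearB /= -koszul_mulmx -yy xy' subrr.
  have [w gw xw] := graded_lift Mh (gradedB gx (graded_koszul gy)) im.
  exists (const_part w); first exact: in_degree_const_part.
  by rewrite -const_part_mulmx -xw linearB /= const_part_koszul subr0.
Qed.

(** A cycle z of K (x) F is lifted to x in F. Its image M' x has no constant term,
    so it is d y in the Koszul complex of the next module, and M'' y is a cycle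
    of the following image; the zig-zag x, y links z and M'' y. *)
Lemma tor_succ_koszul r r' r'' r''' (g : 'I_r -> int) (g' : 'I_r' -> int)
    (g'' : 'I_r'' -> int) (g''' : 'I_r''' -> int)
    (M : 'M[S]_(r, r')) (M' : 'M[S]_(r', r'')) (M'' : 'M[S]_(r'', r''')) j d :
  homog_mx g g' M -> homog_mx g' g'' M' -> homog_mx g'' g''' M'' ->
  exact_at M M' -> exact_at M' M'' ->
  quotient_dim (fun z => in_degree g' j z /\ z *m map_mx (mcoeff 0%MM) M' = 0)
    (fun z => exists2 w, in_degree g j w & z = w *m map_mx (mcoeff 0%MM) M) d ->
  quotient_dim (koszul_cycles g''' (image_chain M'') 1 j)
               (koszul_boundaries g''' (image_chain M'') 1 j) d.
Proof.
move=> Mh Mh' Mh'' ex ex'.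
have MM x : mulmx_chain M' (mulmx_chain M x) = 0 by apply/ex; exists x.
have MM' x : mulmx_chain M'' (mulmx_chain M' x) = 0 by apply/ex'; exists x.
apply: (quotient_dim_transfer (rho := fun z c' =>
  exists x y, [/\ graded g' 0 j x, graded g'' 1 j y, mulmx_chain M' x = koszul y
    & z = const_part x /\ c' = mulmx_chain M'' y])).
- by exists 0, 0; split; rewrite ?linear0 //; apply: graded0.
- move=> u z1 z2 c1 c2 [x1 [y1 [gx1 gy1 xy1 [-> ->]]]] [x2 [y2 [gx2 gy2 xy2 [-> ->]]]].
  exists (u *: x1 + x2), (u *: y1 + y2).
  by split; rewrite ?linearD ?linearZ /= ?xy1 ?xy2 //; apply: graded_linear.
- move=> z [zj z0]; have gz := graded_const_chain zj.
  have gMz := graded_mulmx Mh' gz.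
  have [||y gy xy] := koszul_lift gMz.
  + exact: koszul_deg0 gMz.
  + by rewrite const_part_mulmx const_chainK.
  exists (mulmx_chain M'' y); last by exists (const_chain z), y; rewrite const_chainK.
  split; [exact: graded_mulmx Mh'' gy | by exists y | by rewrite koszul_mulmx -xy MM'].
- move=> c' [gc' Nc' c0]; have [y gy cy] := graded_lift Mh'' gc' Nc'.
  have im : image_chain M' (koszul y) by apply/ex'; rewrite -koszul_mulmx -cy.
  have [x gx yx] := graded_lift Mh' (graded_koszul gy) im.
  exists (const_part x); last by exists x, y.
  split; first exact: in_degree_const_part.
  by rewrite -const_part_mulmx -yx const_part_koszul.
- move=> _ _ [x [y [gx gy xy [-> ->]]]]; split=> [[w wj xw]|[t' [gt' Nt' yt']]].
    have gxw := gradedB gx (graded_mulmx Mh (graded_const_chain wj)).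
    have [||u gu xu] := koszul_lift gxw.
    + exact: koszul_deg0 gxw.
    + by rewrite linearB /= const_part_mulmx const_chainK xw subrr.
    have gyu := gradedB gy (graded_mulmx Mh' gu).
    have [||t gt yt] := koszul_lift gyu.
    + by rewrite linearB /= koszul_mulmx -xu linearB /= MM subr0 xy subrr.
    + exact: const_part_pos gyu.
    exists (mulmx_chain M'' t); split; [exact: graded_mulmx Mh'' gt | by exists t |].
    by rewrite koszul_mulmx -yt linearB /= MM' subr0.
  have [t gt tt] := graded_lift Mh'' gt' Nt'.
  (* correct y, then x, so that both boundaries vanish exactly *)
  have im : image_chain M' (y - koszul t).
    by apply/ex'; rewrite linearB /= -koszul_mulmx -tt yt' subrr.
  have [u gu yu] := graded_lift Mh' (gradedB gy (graded_koszul gt)) im.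
  have im' : image_chain M (x - koszul u).
    by apply/ex; rewrite linearB /= -koszul_mulmx -yu linearB /= koszulK subr0 xy subrr.
  have [w gw xw] := graded_lift Mh (gradedB gx (graded_koszul gu)) im'.
  exists (const_part w); first exact: in_degree_const_part.
  by rewrite -const_part_mulmx -xw linearB /= const_part_koszul subr0.
Qed.

End Balancing.

(** * Betti numbers as Koszul homology *)

Section Resolution.
Variables (K : fieldType) (n : nat) (I : {mpoly K[n]} -> Prop) (F : free_chain K n).
Hypothesis n_gt0 : (0 < n)%N.
Hypothesis F_res : graded_free_resolution I F.
Notation S := {mpoly K[n]}.
Notation chain r := {ffun {set 'I_n} * 'I_r -> S}.

(** The augmented complex ... -> F_1 -> F_0 -> S with S in position 0, so that the
    augmentation and the differentials are treated alike. *)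
Definition aug_rank l := if l is l'.+1 then frank F l' else 1%N.

Definition aug_deg l : 'I_(aug_rank l) -> int :=
  match l with 0 => fun => 0 | l'.+1 => @fdeg _ _ F l' end.

Definition aug_diff l : 'M[S]_(aug_rank l.+1, aug_rank l) :=
  match l with 0 => aug F | l'.+1 => diff F l' end.

Lemma aug_diff_homog l : homog_mx (@aug_deg l.+1) (@aug_deg l) (aug_diff l).
Proof.
case: l => [|l] b b' /=; last exact: diff_homog F_res l b b'.
by rewrite (ord1 b') subr0; apply: aug_homog F_res b.
Qed.

Lemma mulmx_chain_row r r' (M : 'M[S]_(r, r')) (c : chain r) s :
  (\row_b mulmx_chain M c (s, b)) = (\row_b c (s, b)) *m M.
Proof.
by apply/rowP=> b; rewrite !mxE ffunE; apply: eq_bigr => e _; rewrite mxE.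
Qed.

Lemma image_chainP r r' (M : 'M[S]_(r, r')) (c : chain r') :
  image_chain M c <-> forall s, exists w : 'rV_r, \row_b c (s, b) = w *m M.
Proof.
split=> [[x ->] s|h]; first by exists (\row_b x (s, b)); rewrite mulmx_chain_row.
have [w wP] := fin_all_exists (P := fun s (w : 'rV_r) => \row_b c (s, b) = w *m M) h.
exists [ffun x : {set 'I_n} * 'I_r => w x.1 0 x.2]; apply/ffunP=> -[s b].
have /rowP/(_ b) := wP s; rewrite !mxE ffunE /= => ->.
by apply: eq_bigr => e _; rewrite ffunE.
Qed.

Lemma aug_diff_exact l : exact_at (aug_diff l.+1) (aug_diff l).
Proof.
have ex (v : 'rV_(aug_rank l.+1)) :
    v *m aug_diff l = 0 <-> exists w, v = w *m aug_diff l.+1.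
  by case: l v => [|l] v; [apply: aug_exact F_res v|apply: diff_exact F_res l v].
move=> c; rewrite image_chainP; split=> [c0 s|h].
  apply/ex; rewrite -mulmx_chain_row c0; apply/rowP=> b; by rewrite !mxE ffunE.
apply/ffunP=> -[s b]; rewrite [RHS]ffunE; have /ex := h s.
by rewrite -mulmx_chain_row => /rowP/(_ b); rewrite !mxE.
Qed.

Lemma image_chain_aug (c : chain 1) :
  image_chain (aug_diff 0) c <-> forall s, I (c (s, ord0)).
Proof.
have row1 s : \row_b c (s, b) = (c (s, ord0))%:M :> 'M_(1, 1).
  by apply/rowP=> b; rewrite (ord1 b) !mxE.
rewrite image_chainP; split=> h s.
  by have [w e] := h s; apply/(aug_image F_res); exists w; rewrite -e row1.
by have /(aug_image F_res)[w e] := h s; exists w; rewrite row1.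
Qed.

Lemma degree_partP i j (z : 'rV[K]_(frank F i)) :
  (z <= degree_part F i j)%MS <-> in_degree (@fdeg _ _ F i) j z.
Proof.
have mulD (w : 'rV[K]_(frank F i)) b :
    (w *m degree_part F i j) 0 b = w 0 b * (fdeg b == j)%:R.
  by rewrite mul_mx_diag !mxE.
split=> [/submxP[w ->] b|zj].
  by rewrite mulD; case: (fdeg b =P j) => //; rewrite mulr0 eqxx.
apply/submxP; exists z; apply/rowP=> b; rewrite mulD.
have [->|/zj ->] := eqVneq (z 0 b) 0; first by rewrite mul0r.
by rewrite eqxx mulr1.
Qed.

Lemma tor_boundariesP i j (z : 'rV[K]_(frank F i)) :
  (z <= tor_boundaries F i j)%MS <->
  exists2 w, in_degree (@fdeg _ _ F i.+1) j w & z = w *m tensor_diff F i.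
Proof.
rewrite /tor_boundaries; split=> [/submxP[w ->]|[w /degree_partP/submxP[u ->] ->]].
  exists (w *m degree_part F i.+1 j); last by rewrite mulmxA.
  by apply/degree_partP; apply: submxMl.
by apply/submxP; exists u; rewrite mulmxA.
Qed.

(** Iterated connecting isomorphisms move down the resolution, raising the Koszul
    degree at each step, until the ideal itself is reached. *)
Lemma koszul_descent l p j d :
  quotient_dim (koszul_cycles (@aug_deg l) (image_chain (aug_diff l)) p.+1 j)
               (koszul_boundaries (@aug_deg l) (image_chain (aug_diff l)) p.+1 j) d ->
  quotient_dim (koszul_cycles (@aug_deg 0) (image_chain (aug_diff 0)) (p + l).+1 j)
               (koszul_boundaries (@aug_deg 0) (image_chain (aug_diff 0)) (p + l).+1 j) d.
Proof.
elim: l p => [|l IHl] p; first by rewrite addn0.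
rewrite -addSnnS => h; apply: IHl.
exact: (koszul_connecting n_gt0 (aug_diff_homog (l := l.+1)) (aug_diff_homog (l := l))
  (aug_diff_exact (l := l)) h).
Qed.

Lemma betti_koszul i j :
  quotient_dim (koszul_cycles (@aug_deg 0) (image_chain (aug_diff 0)) i j)
               (koszul_boundaries (@aug_deg 0) (image_chain (aug_diff 0)) i j)
               (betti F i j).
Proof.
have := quotient_dim_mx (tor_cycles F i j) (tor_boundaries F i j).
rewrite -/(betti F i j); case: i => [|i] H.
  apply: (tor0_koszul n_gt0 (aug_diff_homog (l := 1)) (aug_diff_homog (l := 0))
    (aug_diff_exact (l := 0))).
  by apply: eq_quotient_dim H => z; [apply: degree_partP | apply: tor_boundariesP].
rewrite -[i]add0n; apply: koszul_descent.
apply: (tor_succ_koszul n_gt0 (aug_diff_homog (l := i.+2)) (aug_diff_homog (l := i.+1))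
  (aug_diff_homog (l := i)) (aug_diff_exact (l := i.+1)) (aug_diff_exact (l := i))).
apply: eq_quotient_dim H => z; last exact: tor_boundariesP.
rewrite /= sub_capmx; split=> [/andP[/degree_partP ? /sub_kermxP ?] //|[zj z0]].
by apply/andP; split; [apply/degree_partP | apply/sub_kermxP].
Qed.

End Resolution.

(** * Koszul homology of a Stanley-Reisner ideal *)

Section Hochster.
Variables (K : fieldType) (n : nat) (D : {set {set 'I_n}}).
Hypothesis D_down : forall s t : {set 'I_n}, s \in D -> t \subset s -> t \in D.
Notation S := {mpoly K[n]}.
Notation chain := {ffun {set 'I_n} * 'I_1 -> S}.
Notation T := ({set 'I_n} * {set 'I_n})%type.
Notation V := {ffun T -> K^o}.
Implicit Types (s t W : {set 'I_n}) (k : 'I_n) (a m : 'X_{1..n}) (c d : chain).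

Definition support m : {set 'I_n} := [set k | (0 < m k)%N].

Lemma support_sqfree s : support (sqfree s) = s.
Proof. by apply/setP=> k; rewrite inE sqfreeE; case: (k \in s). Qed.

Lemma nonface_up s t : s \notin D -> s \subset t -> t \notin D.
Proof. by move=> sD st; apply: contra sD => tD; apply: D_down tD st. Qed.

Lemma prod_var s : \prod_(k in s) 'X_k = 'X_[sqfree s] :> S.
Proof.
rewrite mprodXE; congr 'X_[_]; apply/mnmP=> l; rewrite mnm_sumE sqfreeE.
rewrite (eq_bigr (fun k => (k == l : nat))); last by move=> k _; rewrite mnm1E.
case ls: (l \in s); last first.
  by rewrite big1 // => k ks; case: eqP => // e; rewrite -e ks in ls.
by rewrite (bigD1 l) //= eqxx big1 // => k /andP[_ /negPf ->].
Qed.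

Lemma sr_idealP (p : S) :
  sr_ideal D p <-> forall m, p@_m != 0 -> support m \notin D.
Proof.
split=> [[q ->] m|h].
  rewrite raddf_sum /= => nz.
  have [s sD sm] : exists2 s, s \notin D & (q s * \prod_(k in s) 'X_k)@_m != 0.
    apply/exists_inP; apply: contraNT nz; rewrite negb_exists_in => /forall_inP z.
    by rewrite big1 // => s /z; rewrite negbK => /eqP.
  apply: nonface_up sD _; move: sm; rewrite prod_var -mcoeff_msupp (perm_mem (msuppMX _ _)).
  case/mapP=> m' _ ->; apply/subsetP=> k ks; rewrite inE mnmDE sqfreeE ks; lia.
exists (fun s => \sum_(m <- msupp p | support m == s) p@_m *: 'X_[m - sqfree s]).
rewrite {1}(mpolyE p) big_seq (partition_big support (fun s => s \notin D)) /=; last first.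
  by move=> m; rewrite mcoeff_msupp => /h.
apply: eq_bigr => s _; rewrite prod_var mulr_suml big_seq_cond [RHS]big_seq_cond.
rewrite (eq_bigl (fun m => (m \in msupp p) && (support m == s))); last first.
  by move=> m; rewrite /= andbA andbb.
apply: eq_bigr => m /andP[_ /eqP e]; rewrite -scalerAl -mpolyXD submK //.
by apply/sqfree_le=> k; rewrite -e inE.
Qed.

Definition in_ideal c := forall s, sr_ideal D (c (s, ord0)).

Lemma slice_neq0 r (c : {ffun {set 'I_n} * 'I_r -> S}) a b s : slice c a b s != 0 ->
  (sqfree s <= a)%MM /\ (c (s, b))@_(a - sqfree s) != 0.
Proof. by rewrite /slice; case: ifP => // _; rewrite eqxx. Qed.

Lemma in_idealP c :
  in_ideal c <-> forall a s, slice c a ord0 s != 0 -> support (a - sqfree s) \notin D.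
Proof.
split=> [h a s /slice_neq0[_]|h s]; first exact: (proj1 (sr_idealP _) (h s)).
apply/sr_idealP=> m mc; have := h (m + sqfree s)%MM s.
by rewrite /slice lem_addl addmK => /(_ mc).
Qed.

Lemma in_ideal_graded g p j c : in_ideal c -> in_ideal (graded_part g p j c).
Proof.
move=> h s; apply/sr_idealP=> m; rewrite ffunE /=; case: ifP; last by rewrite mcoeff0 eqxx.
by rewrite mcoeff_degree_component; case: ifP; rewrite ?eqxx // => _ _; apply: (proj1 (sr_idealP _) (h s)).
Qed.

Lemma in_ideal_linear u c d : in_ideal c -> in_ideal d -> in_ideal (u *: c + d).
Proof.
move=> hc hd s; apply/sr_idealP=> m; rewrite !ffunE mcoeffD mcoeffZ.
have [c0|/(proj1 (sr_idealP _) (hc s)) //] := eqVneq ((c (s, ord0))@_m) 0.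
by rewrite c0 mulr0 add0r; apply: (proj1 (sr_idealP _) (hd s)).
Qed.

Lemma in_ideal_koszul c : in_ideal c -> in_ideal (koszul c).
Proof.
move/in_idealP=> h; apply/in_idealP=> a s; rewrite slice_koszul /boundary => nz.
have [k nzk] : exists k, contract k (slice c a ord0) s != 0.
  apply/existsP; apply: contraNT nz; rewrite negb_exists => /forallP z.
  by rewrite big1 // => k _; apply/eqP; have := z k; rewrite negbK.
move: nzk; rewrite /contract; case: ifP => [|ks]; first by rewrite eqxx.
rewrite mulf_eq0 negb_or => /andP[_ /h nD].
apply: nonface_up nD _; apply/subsetP=> l; rewrite !inE !mnmBE !sqfreeE !inE.
by case: (l == k); case: (l \in s) => /=; lia.
Qed.

Definition nonfaces p (j : int) := [set s | (s \notin D) && ((#|s| + p)%:Z == j)].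

Definition cycle_cells p j := cells p (nonfaces p j).

Lemma cycle_cellsP p j W s : reflect
  [/\ s \subset W, #|s| = p, W :\: s \notin D & #|W|%:Z = j] (cycle_cells p j (W, s)).
Proof.
have cardW : s \subset W -> #|W| = (#|W :\: s| + #|s|)%N.
  by move=> sW; rewrite cardsD (setIidPr sW) subnK // subset_leq_card.
apply: (iffP and3P) => /= [[sW /eqP sp]|[sW sp nD Wj]].
  by rewrite inE => /andP[nD /eqP Wj]; split; rewrite // (cardW sW) sp.
by split; rewrite ?sp // inE nD -sp -cardW // Wj eqxx.
Qed.

(** For a squarefree monomial ideal only the squarefree multidegrees carry homology. *)
Definition sq_part c : V := [ffun x : T => slice c (sqfree x.1) ord0 x.2].

Lemma slot_sq_part c W : slot (sq_part c) W =1 slice c (sqfree W) ord0.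
Proof. by move=> s; rewrite /slot ffunE. Qed.

Lemma sq_part_is_linear : linear sq_part.
Proof.
move=> u c d; apply/ffunP=> x; rewrite !ffunE /slice; case: ifP => _.
  by rewrite !ffunE mcoeffD mcoeffZ.
by rewrite scaler0 addr0.
Qed.

HB.instance Definition _ := GRing.isLinear.Build K chain V _ sq_part sq_part_is_linear.

Lemma sq_part_koszul c : sq_part (koszul c) = bd K n (sq_part c).
Proof.
apply/ffunP=> -[W s]; rewrite bdE ffunE /= slice_koszul.
by apply: eq_boundary => t; rewrite slot_sq_part.
Qed.

Lemma sqfree_leP s W : (sqfree s <= sqfree W)%MM = (s \subset W).
Proof.
apply/sqfree_le/subsetP=> h k /h; rewrite sqfreeE; by case: (k \in W).
Qed.

Lemma sqfreeB s W : (sqfree W - sqfree s)%MM = sqfree (W :\: s).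
Proof.
apply/mnmP=> k; rewrite mnmBE !sqfreeE inE.
by case: (k \in W); case: (k \in s).
Qed.

Lemma sq_part_cycle_cells p j c :
  graded (fun=> 0) p j c -> in_ideal c -> sq_part c \in coord_space K (cycle_cells p j).
Proof.
move=> /gradedP gc /in_idealP hc; apply/coord_spaceP=> -[W s]; apply: contraNeq.
rewrite ffunE /= => nz; have nD := hc _ _ nz.
have [sW nz'] := slice_neq0 nz; have [sp e] := gc _ _ _ nz'.
rewrite sqfree_leP in sW; rewrite sqfreeB support_sqfree in nD.
apply/cycle_cellsP; split=> //.
rewrite sqfreeB mdeg_sqfree addr0 -sp -PoszD in e.
by rewrite -e cardsD (setIidPr sW) subnK // subset_leq_card.
Qed.

(** A section of [sq_part] over the functions supported on cells. *)
Definition sq_chain (w : V) : chain :=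
  unslice [seq sqfree W | W <- enum {: {set 'I_n}}] (fun a _ s => w (support a, s)).

Lemma sqfree_enum_uniq : uniq [seq @sqfree n W | W <- enum {: {set 'I_n}}].
Proof. by rewrite map_inj_uniq ?enum_uniq //; apply: can_inj support_sqfree. Qed.

Lemma slice_sq_chain w a b s : slice (sq_chain w) a b s != 0 ->
  a = sqfree (support a) /\ slice (sq_chain w) a b s = w (support a, s).
Proof.
rewrite (slice_unslice _ _ _ _ sqfree_enum_uniq); case: ifP => [|_]; last by rewrite eqxx.
by case/andP=> /mapP[W _ ->] _ _; rewrite support_sqfree.
Qed.

Lemma sq_chainK p j (w : V) : w \in coord_space K (cycle_cells p j) -> sq_part (sq_chain w) = w.
Proof.
move/coord_spaceP=> w0.
apply/ffunP=> -[W s]; rewrite ffunE /= (slice_unslice _ _ _ _ sqfree_enum_uniq).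
rewrite map_f ?mem_enum //= support_sqfree sqfree_leP; case: ifP => // sW.
by rewrite w0 //; apply/cycle_cellsP; case; rewrite sW.
Qed.

Lemma sq_chain_cells p j (w : V) : w \in coord_space K (cycle_cells p j) ->
  graded (fun=> 0) p j (sq_chain w) /\ in_ideal (sq_chain w).
Proof.
move/coord_spaceP=> w0.
have nz a s : slice (sq_chain w) a ord0 s != 0 ->
    exists W, a = sqfree W /\ cycle_cells p j (W, s).
  move=> nz; have [e ew] := slice_sq_chain nz; exists (support a); split=> //.
  by apply: contraNT nz => /w0 z; rewrite ew z.
split.
  apply/gradedP=> s b m; rewrite (ord1 b) => mc.
  have [|W [eW /cycle_cellsP[_ sp _ Wj]]] := nz (m + sqfree s)%MM s.
    by rewrite /slice lem_addl addmK.
  split=> //; rewrite addr0 -Wj -mdeg_sqfree -eW mdegD mdeg_sqfree sp; lia.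
apply/in_idealP=> a s /nz[W [-> /cycle_cellsP[_ _ nD _]]].
by rewrite sqfreeB support_sqfree.
Qed.

Lemma koszul_sq_chain p j (w : V) : w \in coord_space K (cycle_cells p j) ->
  bd K n w = 0 -> koszul (sq_chain w) = 0.
Proof.
move=> wU w0; apply: slice_inj => a b s.
rewrite slice_koszul (ord1 b) [RHS]/slice ffunE mcoeff0 if_same.
have [->|ne] := eqVneq a (sqfree (support a)).
  rewrite -(eq_boundary (slot_sq_part _ _)) (sq_chainK wU) -bdE w0; exact: ffunE.
rewrite /boundary big1 // => k _; rewrite /contract; case: ifP => // _.
have [->|/slice_sq_chain[e _]] := eqVneq (slice (sq_chain w) a ord0 (k |: s)) 0.
  by rewrite mulr0.
by rewrite -e eqxx in ne.
Qed.

(** In a multidegree a divisible by x_k^2 membership of x^(a - s) in a squarefree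
    ideal does not depend on whether k lies in s, so the part of the ideal is a
    cone with apex k. *)
Lemma non_squarefree_acyclic c (n_gt0 : (0 < n)%N) : koszul c = 0 -> in_ideal c -> sq_part c = 0 ->
  exists2 d, in_ideal d & koszul d = c.
Proof.
move=> c0 hc sq0; pose x0 := Ordinal n_gt0.
pose kappa (a : 'X_{1..n}) := odflt x0 [pick k | (1 < a k)%N].
have kappaP a s : slice c a ord0 s != 0 -> (1 < a (kappa a))%N.
  rewrite /kappa; case: pickP => [//|a1]; apply: contraNT => _.
  have -> : a = sqfree (support a).
    apply/mnmP=> k; rewrite sqfreeE inE; have := a1 k; case: (a k) => [|[|]] //.
  by have /ffunP/(_ (support a, s)) := sq0; rewrite !ffunE /= => ->.
have [|d dc dE] := koszul_homotopy (kappa := kappa) c0.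
  by move=> a b s; rewrite (ord1 b) => /kappaP/ltnW.
exists d => //; apply/in_idealP=> a s; rewrite dE /wedge; case: ifP => [ks|]; last by rewrite eqxx.
rewrite mulf_eq0 negb_or => /andP[_ nz]; have a1 := kappaP _ _ nz.
have := proj1 (in_idealP c) hc _ _ nz; apply: contra; congr (_ \in D).
apply/setP=> k; rewrite !inE !mnmBE !sqfreeE !inE.
by case: (k =P kappa a) => [->|] //=; rewrite ks; lia.
Qed.

(** A cycle is linked with its squarefree part. If that part is a boundary, it is
    the boundary of a chain in squarefree multidegrees, and what is left of the
    cycle has no squarefree part. *)
Lemma koszul_hochster p j r (n_gt0 : (0 < n)%N) :
  quotient_dim (koszul_cycles (fun=> 0) in_ideal p j)
               (koszul_boundaries (fun=> 0) in_ideal p j) r ->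
  quotient_dim (fun w : V => w \in (coord_space K (cycle_cells p j) :&: lker (bd K n))%VS)
               (fun w : V => w \in (bd K n @: coord_space K (cycle_cells p.+1 j))%VS) r.
Proof.
have lin_cycle u c d : koszul_cycles (fun=> 0) in_ideal p j c ->
    koszul_cycles (fun=> 0) in_ideal p j d -> koszul_cycles (fun=> 0) in_ideal p j (u *: c + d).
  move=> [gc hc c0] [gd hd d0]; split; [exact: graded_linear|exact: in_ideal_linear|].
  by rewrite linearD linearZ /= c0 d0 scaler0 addr0.
apply: (quotient_dim_transfer (rho := fun c w =>
  koszul_cycles (fun=> 0) in_ideal p j c /\ w = sq_part c)).
- split; last by rewrite linear0.
  split; rewrite ?linear0 //; first exact: graded0.
  by move=> s; apply/sr_idealP=> m; rewrite ffunE mcoeff0 eqxx.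
- move=> u c d w w' [hc ->] [hd ->]; split; first exact: lin_cycle.
  by rewrite linearD linearZ.
- move=> c hc; exists (sq_part c) => //; case: hc => gc ic c0.
  rewrite memv_cap sq_part_cycle_cells //=.
  by rewrite memv_ker -sq_part_koszul c0 linear0.
- move=> w; rewrite memv_cap => /andP[wU]; rewrite memv_ker => /eqP w0.
  have [gw iw] := sq_chain_cells wU; have wK := sq_chainK wU.
  have kw : koszul (sq_chain w) = 0 by apply: koszul_sq_chain wU w0.
  by exists (sq_chain w).
- move=> c _ [[gc ic c0] ->]; split=> [[d [gd id_ ->]]|/memv_imgP[u uU cu]].
    by rewrite sq_part_koszul memv_img // sq_part_cycle_cells.
  have [gu iu] := sq_chain_cells uU; have uK := sq_chainK uU.
  have [||| d id_ dE] := @non_squarefree_acyclic (c - koszul (sq_chain u)) n_gt0.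
  + by rewrite linearB /= c0 koszulK subrr.
  + by rewrite addrC -scaleN1r; apply: in_ideal_linear => //; apply: in_ideal_koszul.
  + by rewrite linearB /= sq_part_koszul uK cu subrr.
  (* the primitive d need not be homogeneous *)
  exists (graded_part (fun=> 0) p.+1 j (sq_chain u + d)); split.
  + exact: graded_part_graded.
  + by apply: in_ideal_graded; rewrite -[sq_chain u]scale1r; apply: in_ideal_linear.
  + by rewrite -graded_part_koszul linearD /= dE addrC subrK gc.
Qed.

End Hochster.

(** * The Betti number formula and the comparison *)

Section BettiFormula.
Variables (K : fieldType) (n : nat) (n_gt0 : (0 < n)%N).
Implicit Types (A D L : {set {set 'I_n}}) (s W : {set 'I_n}).

Lemma bd_cycle_cells D p j : (forall s t : {set 'I_n}, s \in D -> t \subset s -> t \in D) ->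
  (bd K n @: coord_space K (cycle_cells D p.+1 j)
   <= coord_space K (cycle_cells D p j) :&: lker (bd K n))%VS.
Proof.
move=> down; apply/subvP=> _ /memv_imgP[u uU ->].
have [gu iu] := sq_chain_cells down uU; rewrite -(sq_chainK uU) -sq_part_koszul.
rewrite memv_cap; apply/andP; split.
  apply: sq_part_cycle_cells => //; first exact: graded_koszul.
  exact: in_ideal_koszul.
by rewrite memv_ker -sq_part_koszul koszulK linear0.
Qed.

(** Hochster's formula, with the homology of the induced complexes written through
    ranks and summed over all vertex sets W of size j. *)
Lemma betti_sr_ideal D (F : free_chain K n) p j :
  (forall s t : {set 'I_n}, s \in D -> t \subset s -> t \in D) ->
  graded_free_resolution (sr_ideal D) F ->
  betti F p j = (#|cells p (nonfaces D p j)| - bd_rank K p (nonfaces D p j)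
                 - bd_rank K p.+1 (nonfaces D p.+1 j))%N.
Proof.
move=> down res.
have ideal c : image_chain (aug_diff F 0) c <-> in_ideal D c := image_chain_aug res c.
have H : quotient_dim (koszul_cycles (fun=> 0) (in_ideal (K := K) D) p j)
               (koszul_boundaries (fun=> 0) (in_ideal (K := K) D) p j) (betti F p j).
  refine (@eq_quotient_dim _ _ _ _ _ _ _ _ _ (betti_koszul n_gt0 res p j)) => c.
    by split=> -[gc ic c0]; split=> //; apply/ideal.
  by split=> -[d [gd /ideal id_ cd]]; exists d.
have {}H := koszul_hochster down n_gt0 H.
have H' := quotient_dim_vspace (bd_cycle_cells p j down).
have le := quotient_dim_le _ _ H H'; have ge := quotient_dim_le _ _ H' H.
rewrite (_ : betti F p j = \dim (coord_space K (cycle_cells D p j) :&: lker (bd K n))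
   - bd_rank K p.+1 (nonfaces D p.+1 j))%N; last first.
  by apply/eqP; rewrite eqn_leq le ?ge ?mem0v // => a x y xB yB; rewrite memvD ?memvZ.
congr (_ - _)%N; rewrite -(dim_coord_space K (cells p (nonfaces D p j))).
by rewrite -[in RHS](limg_ker_dim (bd K n)) addnK.
Qed.

Lemma card_cells p d A : uniform d A -> #|cells p A| = (#|A| * 'C(n - d, p))%N.
Proof.
move=> Au; rewrite -[LHS]sum1_card.
rewrite (partition_big (fun x : {set 'I_n} * {set 'I_n} => x.1 :\: x.2) (fun sg => sg \in A)) /=; last first.
  by move=> x /and3P[].
rewrite -sum_nat_const; apply: eq_bigr => sg sgA; rewrite sum1_card.
have ground : #|~: sg| = (n - d)%N by rewrite cardsCs setCK card_ord (Au sg sgA).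
rewrite -ground -cards_draws.
have inj : injective (fun t : {set 'I_n} => (sg :|: t, t)) by move=> t t' [].
rewrite -(card_imset _ inj); apply: eq_card => -[W s]; apply/idP/imsetP.
  case/andP=> /and3P[/= sW sp _] /eqP e; exists s.
    by rewrite inE sp andbT -e; apply/subsetP=> z zs; rewrite !inE zs.
  by congr (_, _); rewrite -(setID W s) e (setIidPr sW) setUC.
case=> t; rewrite inE => /andP[tsg tp] [-> ->].
have diffE : (sg :|: t) :\: t = sg.
  apply/setP=> z; rewrite !inE; case zt: (z \in t) => /=; last by rewrite orbF.
  by have := subsetP tsg z zt; rewrite inE => /negPf.
by apply/andP; split; [apply/and3P; split=> //=; [exact: subsetUr|rewrite diffE]|rewrite /= diffE].
Qed.

Lemma nonfaces_uniform D p j : uniform (`|j| - p)%N (nonfaces D p j).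
Proof. by move=> s; rewrite inE => /andP[_ /eqP <-]; rewrite absz_nat addnK. Qed.

(** The f-vector does not count the empty face, but that is a face of every complex
    on a nonempty vertex set. *)
Lemma card_nonfaces D D' p j : simplicial_complex D -> simplicial_complex D' ->
  (forall i, fvector D i = fvector D' i) -> #|nonfaces D p j| = #|nonfaces D' p j|.
Proof.
move=> [v down] [v' down'] ff; pose x := Ordinal n_gt0.
have s0 : set0 \in D by apply: down (v x) (sub0set _).
have s0' : set0 \in D' by apply: down' (v' x) (sub0set _).
have faces d : #|[set s in D | #|s| == d]| = #|[set s in D' | #|s| == d]|.
  case: d => [|d]; last exact: ff.
  suff zero (E : {set {set 'I_n}}) : set0 \in E -> [set s : {set 'I_n} in E | #|s| == 0%N] = [set set0].
    by rewrite !zero.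
  move=> E0; apply/setP=> s; rewrite !inE cards_eq0 andbC.
  by case: eqP => // ->.
have nonf (E : {set {set 'I_n}}) : #|nonfaces E p j| = #|[set s : {set 'I_n} | (#|s| + p)%:Z == j]
        :\: [set s in E | #|s| == `|j| - p]|%N.
  apply: eq_card => s; rewrite !inE; case: eqP => [<-|_]; last by rewrite !andbF.
  by rewrite absz_nat addnK eqxx !andbT.
have meet (E : {set {set 'I_n}}) : [set s : {set 'I_n} | (#|s| + p)%:Z == j] :&: [set s in E | #|s| == `|j| - p]%N
   = if (p%:Z <= j) then [set s in E | #|s| == `|j| - p]%N else set0.
  apply/setP=> s; case: ifP => pj; rewrite !inE.
    by rewrite andb_idl // => /andP[_ /eqP e]; apply/eqP; lia.
  by apply/negbTE; rewrite negb_and; apply/orP; left; apply/eqP=> e; lia.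
by rewrite !nonf !cardsD !meet; case: ifP; rewrite ?faces.
Qed.

Lemma nonfaces_lex_initial D p j : simplicial_complex D -> lexsegment K D ->
  lex_initial n (nonfaces D p j).
Proof.
move=> [_ down] lex u v; rewrite !inE => /andP[uD uj] vu _ /lex_gtP[k [kv ku below]].
rewrite vu uj andbT.
have mem (s : {set 'I_n}) : sr_ideal D ('X_[sqfree s] : {mpoly K[n]}) <-> s \notin D.
  rewrite (sr_idealP down); split=> [/(_ (sqfree s))|sD m].
    by rewrite mcoeffX eqxx oner_eq0 support_sqfree; apply.
  by rewrite mcoeffX; case: (sqfree s =P m) => [<- _|_]; [rewrite support_sqfree|rewrite eqxx].
have sqf (s : {set 'I_n}) : squarefree_mnm (sqfree s).
  by move=> l; rewrite sqfreeE leq_b1.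
apply/mem; apply: lex (sqf u) (sqf v) _ _ _; last exact/mem.
  by rewrite !mdeg_sqfree.
exists k; rewrite !sqfreeE kv (negPf ku); split=> // l lk.
by rewrite !sqfreeE below.
Qed.

End BettiFormula.

(** Both Betti numbers are given by the same formula with the same number of cells;
    the ranks that are subtracted are smaller for the lexsegment complex. *)
Theorem corollary3p5 (K : fieldType) (n : nat) (n_gt0 : (0 < n)%N)
    (D Dlex : {set {set 'I_n}})
    (D_complex : simplicial_complex D)
    (Dlex_complex : simplicial_complex Dlex)
    (Dlex_lex : lexsegment K Dlex)
    (same_f : forall i : nat, fvector Dlex i = fvector D i)
    (F F' : free_chain K n)
    (F_res : graded_free_resolution (sr_ideal D) F)
    (F'_res : graded_free_resolution (sr_ideal Dlex) F')
    (i : nat) (j : int) :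
  (betti F i (i%:Z + j) <= betti F' i (i%:Z + j))%N.
Proof.
rewrite (betti_sr_ideal n_gt0 i _ (proj2 D_complex) F_res).
rewrite (betti_sr_ideal n_gt0 i _ (proj2 Dlex_complex) F'_res).
have card p q : #|nonfaces Dlex p q| = #|nonfaces D p q| by apply: card_nonfaces.
have rk p q : (bd_rank K p (nonfaces Dlex p q) <= bd_rank K p (nonfaces D p q))%N.
  apply: (bd_rank_lex_le _ _ n_gt0 (nonfaces_uniform (D := D) (p := p) (j := q))
    (nonfaces_uniform (D := Dlex) (p := p) (j := q))); last by rewrite card.
  exact: nonfaces_lex_initial Dlex_complex Dlex_lex.
rewrite !(card_cells _ (nonfaces_uniform (D := _) (p := i) (j := _))) card.
by rewrite !leq_sub.
Qed.
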